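(* Let the coefficients $A_0,A_1,C_0,C_1$ satisfy hypothesis (L1) (stated in the context), and let $\varphi(\cdot),\psi(\cdot)\in L^2_{\mathbb F}(0,T;\mathbb R^n)$. Let $X(\cdot)\in L^2_{\mathbb F}(0,T;\mathbb R^n)$ be the solution of the linear mean-field forward stochastic Volterra integral equation $$X(t)=\varphi(t)+\int_0^t\Big(A_0(t,s)X(s)+\mathbb E'[C_0(t,s)X(s)]\Big)ds+\int_0^t\Big(A_1(t,s)X(s)+\mathbb E'[C_1(t,s)X(s)]\Big)dW(s),\quad t\in[0,T],$$ and let $(Y(\cdot),Z(\cdot,\cdot))\in\mathcal M^2[0,T]$ be the adapted M-solution of the linear mean-field backward stochastic Volterra integral equation $$Y(t)=\psi(t)+\int_t^T\Big(A_0(s,t)^TY(s)+A_1(s,t)^TZ(s,t)+\mathbb E^*\big[C_0(s,t)^TY(s)+C_1(s,t)^TZ(s,t)\big]\Big)ds-\int_t^TZ(t,s)dW(s),\quad t\in[0,T].$$ Then $$\mathbb E\int_0^T\langle X(t),\psi(t)\rangle dt=\mathbb E\int_0^T\langle Y(t),\varphi(t)\rangle dt.$$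
   Context: Let $T>0$ and let $(\Omega,\mathcal F,\mathbb F,\mathbb P)$ be a complete filtered probability space on which a one-dimensional standard Brownian motion $W$ is defined, $\mathbb F=\{\mathcal F_t\}_{t\ge0}$ being its natural filtration augmented by all $\mathbb P$-null sets. $(\Omega^2,\mathcal F^2,\mathbb P^2)$ is the completion of the product of $(\Omega,\mathcal F,\mathbb P)$ with itself, and $\mathbb F^2=\{\mathcal F_t\otimes\mathcal F_t\}_{t\in[0,T]}$ (completed). Put $\Delta^*=\{(t,s)\in[0,T]^2: t\ge s\}$. $L^2_{\mathbb F}(0,T;\mathbb R^n)$: $\mathbb F$-adapted processes with $\mathbb E\int_0^T|X(s)|^2ds<\infty$. $\mathcal M^2[0,T]$: pairs $(y,z)$ with $y\in L^2_{\mathbb F}(0,T;\mathbb R^n)$, $z:[0,T]^2\times\Omega\to\mathbb R^n$ with $z(t,\cdot)$ $\mathbb F$-adapted for a.e. $t$, $\mathbb E\int_0^T\int_0^T|z(t,s)|^2dsdt<\infty$, and $y(t)=\mathbb E[y(t)|\mathcal F_S]+\int_S^tz(t,s)dW(s)$ for $t\in[S,T]$, $S\in[0,T)$. An adapted M-solution of a backward equation is a pair $(Y,Z)$ in these spaces satisfying the equation in the Itô sense and $Y(t)=\mathbb EY(t)+\int_0^tZ(t,s)dW(s)$, $t\in[0,T]$. Notation: $\mathbb E'[C_i(t,s)X(s)](\omega)=\int_\Omega C_i(t,s,\omega,\omega')X(s,\omega')\mathbb P(d\omega')$, and $\mathbb E^*$ integrates out the first $\Omega$-variable: $\mathbb E^*[C_0(s,t)^TY(s)](\omega)=\int_\Omega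 C_0(s,t,\omega^*,\omega)^TY(s,\omega^* )\mathbb P(d\omega^* )$, $\mathbb E^*[C_1(s,t)^TZ(s,t)](\omega)=\int_\Omega C_1(s,t,\omega^*,\omega)^TZ(s,t,\omega^* )\mathbb P(d\omega^* )$. A superscript $T$ on a matrix denotes transpose. Hypothesis (L1): $A_0,A_1:\Delta^*\times\Omega\to\mathbb R^{n\times n}$ and $C_0,C_1:\Delta^*\times\Omega^2\to\mathbb R^{n\times n}$ are measurable and uniformly bounded; for any $t\in[0,T]$, $s\mapsto(A_0(t,s),A_1(t,s))$ is $\mathbb F$-progressively measurable on $[0,t]$ and $s\mapsto(C_0(t,s),C_1(t,s))$ is $\mathbb F^2$-progressively measurable on $[0,t]$. (Under (L1) both equations are uniquely solvable in the stated spaces.) *)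

(* Defs.v *)
From HB Require Import structures.
From mathcomp Require Import all_boot all_order all_algebra.
From mathcomp Require Import all_classical all_reals all_analysis.

Set Implicit Arguments.
Unset Strict Implicit.
Unset Printing Implicit Defensive.

Import Order.TTheory GRing.Theory Num.Theory.
Import numFieldNormedType.Exports.

Local Open Scope classical_set_scope.
Local Open Scope ring_scope.

Section vectors.
Context {R : realType} {n : nat}.

(* The library norm on matrices is the max norm, so the Euclidean structure of
   R^n is written out. *)
Definition dotv (u v : 'cV[R]_n) : R := \sum_(i < n) u i 0 * v i 0.

Definition sqnormv (u : 'cV[R]_n) : R := dotv u u.

Definition vint d (T : measurableType d) (mu : {measure set T -> \bar R})
    (D : set T) (f : T -> 'cV[R]_n) : 'cV[R]_n :=
  \col_i \int[mu]_(x in D) f x i 0.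

Definition vmeasurable d (T : measurableType d) (D : set T)
    (f : T -> 'cV[R]_n) : Prop :=
  forall i, measurable_fun D (fun x => f x i 0).

Definition mxmeasurable d (T : measurableType d) (D : set T)
    (f : T -> 'M[R]_n) : Prop :=
  forall i j, measurable_fun D (fun x => f x i j).

End vectors.

Section brownian_filtration.
Context {R : realType} {d : measure_display} {Omega : measurableType d}.
Variables (P : probability Omega R) (W : R -> {RV P >-> R}).

(* Time is indexed by R; only the values W t with 0 <= t are ever used. *)
Definition natural_filtration (t : R) : set (set Omega) :=
  <<s [set A | exists (u : R) (B : set R),
         [/\ 0 <= u <= t, measurable B & A = W u @^-1` B]] >>.

Record brownian_motion : Prop := {
  bm_start : {ae P, forall w, W 0 w = 0} ;
  bm_continuous :
    {ae P, forall w, {within `[0, +oo[, continuous (fun t : R => W t w)}} ;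
  bm_gaussian : forall s t : R, 0 <= s < t -> forall B : set R, measurable B ->
    pushforward P (W t \- W s) B = normal_prob 0 (Num.sqrt (t - s)) B ;
  bm_independent : forall s t : R, 0 <= s < t ->
    forall A, natural_filtration s A -> forall B : set R, measurable B ->
    P (A `&` (W t \- W s) @^-1` B) =
      (P A * P ((W t \- W s)%R @^-1` B))%E }.

Definition filt (t : R) : set (set Omega) :=
  <<s natural_filtration t `|` P.-negligible >>.

(* Completion, for P \x P, of the product of the sigma-algebra G with itself. *)
Definition completed_square (G : set (set Omega)) : set (set (Omega * Omega)) :=
  <<s [set E | exists A B, [/\ G A, G B & E = A `*` B]]
      `|` (P \x P)%E.-negligible >>.

Definition F2 : set (set (Omega * Omega)) := completed_square measurable.

Definition filt2 (t : R) : set (set (Omega * Omega)) :=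
  completed_square (filt t).

End brownian_filtration.

Section ito_integral.
Context {R : realType} {d : measure_display} {Omega : measurableType d}.
Variables (P : probability Omega R) (W : R -> {RV P >-> R}).

Record simple_process (a b : R) := SimpleProcess {
  sp_size : nat ;
  sp_time : nat -> R ;
  sp_val : nat -> Omega -> R ;
  sp_time_itv : forall k, (k <= sp_size)%N -> a <= sp_time k <= b ;
  sp_time_mono : forall k, (k < sp_size)%N -> sp_time k <= sp_time k.+1 ;
  sp_val_adapted : forall k, (k < sp_size)%N ->
    measurable_fun setT
      (sp_val k : g_sigma_algebraType (filt W (sp_time k)) -> R) ;
  sp_val_bounded : exists M : R, forall k w, (k < sp_size)%N ->
    `|sp_val k w| <= M }.

Definition sp_process a b (h : simple_process a b) (s : R) (w : Omega) : R :=
  \sum_(k < sp_size h)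
    sp_val h k w * \1_(`]sp_time h k, sp_time h k.+1] : set R) s.

Definition sp_integral a b (h : simple_process a b) (w : Omega) : R :=
  \sum_(k < sp_size h)
    sp_val h k w * (W (sp_time h k.+1) w - W (sp_time h k) w).

(* I is (a version of) the Ito integral of H over [a, b]: H is, up to
   indistinguishability, a jointly measurable process H' that is the limit in
   L^2(dP x ds) of simple adapted processes whose elementary integrals converge
   to I in L^2(P). The process H' is there because integrands obtained by
   integrating out a variable of a completed product are jointly measurable
   only off a P-null set. *)
Definition is_ito_integral (a b : R) (H : R -> Omega -> R) (I : Omega -> R)
    : Prop :=
  exists (H' : R -> Omega -> R) (h : nat -> simple_process a b),
    [/\ measurable_fun (`[a, b] `*` setT) (fun p : R * Omega => H' p.1 p.2),
        {ae P, forall w, forall s : R, a <= s <= b -> H s w = H' s w},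
        (fun k => \int[P]_w \int[lebesgue_measure]_(s in `[a, b])
           ((H' s w - sp_process (h k) s w) ^+ 2)%:E)%E @ \oo --> 0%E,
        measurable_fun setT I &
        (fun k => \int[P]_w ((I w - sp_integral (h k) w) ^+ 2)%:E)%E
          @ \oo --> 0%E ].

Definition is_vito_integral n (a b : R) (H : R -> Omega -> 'cV[R]_n)
    (I : Omega -> 'cV[R]_n) : Prop :=
  forall i, is_ito_integral a b (fun s w => H s w i 0) (fun w => I w i 0).

End ito_integral.

Section mean_field_volterra.
Context {R : realType} {d : measure_display} {Omega : measurableType d}.
Variables (P : probability Omega R) (W : R -> {RV P >-> R}) (T : R) (n : nat).

Local Notation mu := (@lebesgue_measure R).

Definition L2F (X : R -> Omega -> 'cV[R]_n) : Prop :=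
  [/\ vmeasurable (`[0, T] `*` setT) (fun p : R * Omega => X p.1 p.2),
      (forall t : R, 0 <= t <= T ->
         vmeasurable setT (X t : g_sigma_algebraType (filt W t) -> 'cV[R]_n)) &
      (\int[P]_w \int[mu]_(t in `[0%R, T]) (sqnormv (X t w))%:E < +oo)%E].

Definition is_cond_exp (G : set (set Omega)) (X V : Omega -> R) : Prop :=
  [/\ P.-integrable setT (EFin \o X),
      P.-integrable setT (EFin \o V),
      measurable_fun setT (V : g_sigma_algebraType G -> R) &
      forall A, G A ->
        (\int[P]_(w in A) (V w)%:E = \int[P]_(w in A) (X w)%:E)%E].

Definition M2 (y : R -> Omega -> 'cV[R]_n) (z : R -> R -> Omega -> 'cV[R]_n)
    : Prop :=
  [/\ L2F y,
      vmeasurable ((`[0, T] `*` `[0, T]) `*` setT)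
        (fun p : (R * R) * Omega => z p.1.1 p.1.2 p.2),
      {ae mu, forall t : R, 0 <= t <= T -> forall s : R, 0 <= s <= T ->
         vmeasurable setT
           (z t s : g_sigma_algebraType (filt W s) -> 'cV[R]_n)},
      (\int[P]_w \int[mu]_(t in `[0%R, T]) \int[mu]_(s in `[0%R, T])
         (sqnormv (z t s w))%:E < +oo)%E &
      forall S : R, 0 <= S < T -> {ae mu, forall t : R, S <= t <= T ->
        exists V I : Omega -> 'cV[R]_n,
          [/\ (forall i, is_cond_exp (filt W S)
                 (fun w => y t w i 0) (fun w => V w i 0)),
              is_vito_integral W S t (z t) I &
              {ae P, forall w, y t w = V w + I w}]}].

Definition triangle : set (R * R) := [set p | 0 <= p.2 <= p.1 /\ p.1 <= T].

Definition coef1 (A : R -> R -> Omega -> 'M[R]_n) : Prop :=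
  [/\ mxmeasurable (triangle `*` setT)
        (fun p : (R * R) * Omega => A p.1.1 p.1.2 p.2),
      (exists K : R, forall (t s : R) w i j, triangle (t, s) ->
         `|A t s w i j| <= K) &
      forall t r : R, 0 <= r <= t -> t <= T ->
        mxmeasurable (`[0, r] `*` setT)
          (fun p : R * g_sigma_algebraType (filt W r) => A t p.1 p.2)].

Definition coef2 (C : R -> R -> Omega -> Omega -> 'M[R]_n) : Prop :=
  [/\ mxmeasurable (triangle `*` setT)
        (fun p : (R * R) * g_sigma_algebraType (F2 P) =>
           C p.1.1 p.1.2 p.2.1 p.2.2),
      (exists K : R, forall (t s : R) w w' i j, triangle (t, s) ->
         `|C t s w w' i j| <= K) &
      forall t r : R, 0 <= r <= t -> t <= T ->
        mxmeasurable (`[0, r] `*` setT)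
          (fun p : R * g_sigma_algebraType (filt2 W r) =>
             C t p.1 p.2.1 p.2.2)].

Definition L1 (A0 A1 : R -> R -> Omega -> 'M[R]_n)
    (C0 C1 : R -> R -> Omega -> Omega -> 'M[R]_n) : Prop :=
  [/\ coef1 A0, coef1 A1, coef2 C0 & coef2 C1].

(* E' integrates out the second variable of Omega^2, E^* the first one. *)
Definition Eprime (f : Omega -> Omega -> 'cV[R]_n) (w : Omega) : 'cV[R]_n :=
  vint P setT (fun w' => f w w').

Definition Estar (f : Omega -> Omega -> 'cV[R]_n) (w : Omega) : 'cV[R]_n :=
  vint P setT (fun w' => f w' w).

(* Solutions being L^2 classes, the identities indexed by t below, as in M2, are
   required for almost every t, and P-almost surely for each such t. *)
Definition MF_FSVIE_solution (A0 A1 : R -> R -> Omega -> 'M[R]_n)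
    (C0 C1 : R -> R -> Omega -> Omega -> 'M[R]_n)
    (phi X : R -> Omega -> 'cV[R]_n) : Prop :=
  L2F X /\
  {ae mu, forall t : R, 0 <= t <= T ->
        exists I : Omega -> 'cV[R]_n,
     is_vito_integral W 0 t
       (fun s w => A1 t s w *m X s w +
          Eprime (fun w1 w2 => C1 t s w1 w2 *m X s w2) w) I /\
     {ae P, forall w,
        X t w = phi t w
          + vint mu `[0, t]
              (fun s => A0 t s w *m X s w +
                 Eprime (fun w1 w2 => C0 t s w1 w2 *m X s w2) w)
          + I w}}.

Definition MF_BSVIE_Msolution (A0 A1 : R -> R -> Omega -> 'M[R]_n)
    (C0 C1 : R -> R -> Omega -> Omega -> 'M[R]_n)
    (psi Y : R -> Omega -> 'cV[R]_n) (Z : R -> R -> Omega -> 'cV[R]_n)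
    : Prop :=
  [/\ M2 Y Z,
      {ae mu, forall t : R, 0 <= t <= T ->
        exists I : Omega -> 'cV[R]_n,
         is_vito_integral W t T (Z t) I /\
         {ae P, forall w,
            Y t w = psi t w
              + vint mu `[t, T]
                  (fun s => (A0 s t w)^T *m Y s w + (A1 s t w)^T *m Z s t w +
                     Estar (fun w1 w2 => (C0 s t w1 w2)^T *m Y s w1
                                       + (C1 s t w1 w2)^T *m Z s t w1) w)
              - I w}} &
      {ae mu, forall t : R, 0 <= t <= T ->
        exists I : Omega -> 'cV[R]_n,
         is_vito_integral W 0 t (Z t) I /\
         {ae P, forall w, Y t w = vint P setT (Y t) + I w}}].

End mean_field_volterra.

(* Main.v *)
Require Import Defs.
From HB Require Import structures.
From mathcomp Require Import all_boot all_order all_algebra.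
From mathcomp Require Import all_classical all_reals all_analysis.
From mathcomp Require Import measurable_realfun ring lra.

Set Implicit Arguments.
Unset Strict Implicit.
Unset Printing Implicit Defensive.

Import Order.TTheory GRing.Theory Num.Theory.
Import numFieldNormedType.Exports.

Local Open Scope classical_set_scope.
Local Open Scope ring_scope.


(** The identity is a duality between two linear operators, hidden behind two
    stochastic equations.

    Write [F0 X] and [F1 X] for the drift and the diffusion kernels of the forward
    equation, functions of [(t, s)] on the triangle [s <= t], and [B (Y, Z)] for
    the drift kernel of the backward equation, a function of [(t, s)] on the
    triangle [t <= s].  Test the forward equation at time [t] against [Y t], and
    replace [Y t] by its representation [E (Y t)] plus the Ito integral of [Z t]
    over [0, t] in the stochastic term.  The constant [E (Y t)] is orthogonal to
    an Ito integral and the isometry treats the rest, so that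
    [E <Y t, phi t> = E <Y t, X t> - E int_0^t (<Y t, F0 X> + <Z t, F1 X>) ds]
    ([forward_identity]).  Test the backward equation against [X t], which belongs
    to the past of [t] and hence is orthogonal to the Ito integral over [t, T]
    ([ito_past_orthogonal]):
    [E <X t, psi t> = E <X t, Y t> - E int_t^T <X t, B (Y, Z)> ds]
    ([backward_identity]).  After integration in [t] the two double integrals agree
    ([operator_duality]): at a fixed pair of times the coefficients of [B] are the
    transposes of those of [F0] and [F1], the two copies of [Omega] being exchanged
    by [E'] and [E^*] ([mf_at_adjoint], [mf_op_adjoint]), and Fubini exchanges the
    two times.

    The rest makes these computations legitimate.  The coefficients [C0] and [C1]
    are measurable for a completed product, whose sections are measurable almost
    surely only; they are replaced by functions measurable for the product itself
    that agree with them at all times off a single null set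
    ([completed_product_version], [coef2_version]).  The processes are extended by
    zero to square integrable functions on the product of the time axes and
    [Omega].  The Ito integral is only given as a limit of elementary integrals; its
    isometry and its orthogonality to the past are first proved for simple
    processes, from the first two moments of the increments of [W] and their
    independence of the augmented past ([simple_isometry],
    [expectation_past_simple]), and pass to the limit because inner products are
    continuous ([L2_cvg_inner]). *)

(** * Measurable versions modulo a sigma-ideal *)

Section sets_modulo_ideal.
Variables (T : Type) (I : set (set T)).

Definition eq_mod (A B : set T) : Prop :=
  exists2 M, I M & forall x, ~ M x -> (A x <-> B x).

Hypothesis I0 : I set0.
Hypothesis IU : forall F : (set T)^nat,
  (forall k, I (F k)) -> I (\bigcup_k F k).

Lemma eq_mod_refl A : eq_mod A A.
Proof. by exists set0. Qed.

Lemma eq_mod_bigcup (A B : (set T)^nat) :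
  (forall k, eq_mod (A k) (B k)) -> eq_mod (\bigcup_k A k) (\bigcup_k B k).
Proof.
move=> AB; have /choice[M /all_and2[IM ABM]] : forall k, exists M,
    I M /\ forall x, ~ M x -> (A k x <-> B k x).
  by move=> k; have [M] := AB k; exists M.
exists (\bigcup_k M k); first exact: IU.
move=> x nMx; have nM k : ~ M k x by move=> Mkx; apply: nMx; exists k.
by split=> -[k _] ?; exists k => //; apply/ABM.
Qed.

(** Being equal to a member of a sigma-algebra modulo a sigma-ideal passes from
    generators to the generated sigma-algebra, because the sets that enjoy it
    are closed under complement and countable union. *)
Lemma generated_eq_mod (G gens : set (set T)) :
  sigma_algebra setT G ->
  (forall A, gens A -> exists2 B, G B & eq_mod A B) ->
  forall A, <<s gens >> A -> exists2 B, G B & eq_mod A B.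
Proof.
move=> [G0 GC GU] gensG; apply: smallest_sub => //.
split.
- by exists set0 => //; exact: eq_mod_refl.
- move=> A [B GB [M IM AB]]; exists (~` B); first by rewrite -setTD; exact: GC.
  exists M => // x nMx; rewrite setTD /=.
  by split=> nA /(AB x nMx).
- move=> F FG; have /choice[B /all_and2[GB FB]] : forall k, exists B,
      G B /\ eq_mod (F k) B by move=> k; have [B] := FG k; exists B.
  by exists (\bigcup_k B k); [exact: GU|exact: eq_mod_bigcup].
Qed.

End sets_modulo_ideal.

Section measurable_version.
Context d (T : measurableType d) (R : realType).
Variable I : set (set T).
Hypothesis IU : forall F : (set T)^nat,
  (forall k, I (F k)) -> I (\bigcup_k F k).

(** The measurable version of [f] is rebuilt from its superlevel sets at the
    rational levels: off the union of the countably many exceptional sets, [f]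
    is the supremum of the rationals that it exceeds. *)
Lemma measurable_version (D : set T) (f : T -> R) (K : R) :
  measurable D -> 0 <= K -> (forall x, D x -> `|f x| <= K) ->
  (forall q : R, exists2 B, measurable B &
     eq_mod I [set x | D x /\ q < f x] B) ->
  exists g : T -> R, [/\ measurable_fun setT g, (forall x, `|g x| <= K),
    (forall x, ~ D x -> g x = 0) &
    exists2 M, I M & forall x, ~ M x -> D x -> g x = f x].
Proof.
move=> mD K0 fK fB.
pose q k : R := ratr (odflt 0 (unpickle k : option rat)).
have /choice[B /all_and2[mB BM]] : forall k, exists B, measurable B /\
    eq_mod I [set x | D x /\ q k < f x] B.
  by move=> k; have [B] := fB (q k); exists B.
have /choice[M /all_and2[IM fBM]] : forall k, exists M,
    I M /\ forall x, ~ M x -> (D x /\ q k < f x <-> B k x).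
  by move=> k; have [N] := BM k; exists N.
pose c (r : R) := Num.max (- K) (Num.min K r).
have cK r : - K <= c r <= K.
  by rewrite /c le_max lexx/= ge_max ge_min lexx/= andbT; lra.
have cid r : - K <= r <= K -> c r = r.
  by move=> /andP[? ?]; rewrite /c min_r// max_r.
pose h k x := if x \in B k then c (q k) else - K.
have hK k x : - K <= h k x <= K.
  by rewrite /h; case: ifPn => _ //; rewrite lexx/=; lra.
have h_ub x : has_ubound (range (h ^~ x)).
  by exists K => _ [k _ <-]; have /andP[] := hK k x.
have mh k : measurable_fun setT (h k).
  apply: measurable_fun_ifT => //.
  by apply: (measurable_fun_bool true); rewrite setTI preimage_mem_true.
pose s x := sups (h ^~ x) 0%N.
have ms : measurable_fun setT s by exact: measurable_fun_sups.
have s_ge k x : h k x <= s x.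
  by apply: ub_le_sup; [exact/has_ubound_sdrop|exists k].
have s_le x r : (forall k, h k x <= r) -> s x <= r.
  move=> hr; apply: ge_sup; first by exists (h 0%N x), 0%N.
  by move=> _ [k _ <-].
have sK x : - K <= s x <= K.
  apply/andP; split; last by apply: s_le => k; have /andP[] := hK k x.
  by apply: le_trans (s_ge 0%N x); have /andP[] := hK 0%N x.
exists (fun x => if x \in D then s x else 0); split.
- apply: measurable_fun_ifT => //.
  by apply: (measurable_fun_bool true); rewrite setTI preimage_mem_true.
- by move=> x; case: ifPn => _; rewrite ?normr0// ler_norml.
- by move=> x nDx; rewrite memNset.
exists (\bigcup_k M k); first exact: IU.
move=> x nMx Dx; rewrite mem_set//.
have nM k : ~ M k x by move=> ?; apply: nMx; exists k.
have /andP[fK1 fK2] : - K <= f x <= K by rewrite -ler_norml fK.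
apply/eqP; rewrite eq_le; apply/andP; split.
  apply: s_le => k; rewrite /h; case: ifPn => // /set_mem /(fBM k x (nM k))[_].
  rewrite /c; move=> qf; rewrite ge_max fK1/= ge_min; apply/orP; right.
  exact: ltW.
rewrite leNgt; apply/negP => sf.
have [r] := rat_in_itvoo sf; rewrite in_itv/= => /andP[sr rf].
have := s_ge (pickle r) x; rewrite leNgt => /negP; apply.
have qr : q (pickle r) = ratr r by rewrite /q pickleK.
rewrite /h mem_set; last by apply/fBM; [exact: nM|rewrite qr].
have /andP[? ?] := sK x.
by rewrite qr cid//; apply/andP; split; lra.
Qed.

End measurable_version.

Lemma measurable_set_le d (T : measurableType d) (R : realType) (f g : T -> R) :
  measurable_fun setT f -> measurable_fun setT g ->
  measurable [set x | f x <= g x].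
Proof.
move=> mf mg; rewrite -[X in measurable X]setTI.
by have := measurable_fun_ler mf mg; move=> /(_ measurableT [set true]); exact.
Qed.

(** * Completion of a product of probability spaces *)

Section completed_product.
Context {R : realType} {d : measure_display} {Omega : measurableType d}.
Variable P : probability Omega R.

Lemma F2_eq_mod (A : set (Omega * Omega)) : F2 P A ->
  exists2 B, measurable B & eq_mod (P \x P)%E.-negligible A B.
Proof.
apply: generated_eq_mod.
- exact: negligible_set0.
- exact: negligible_bigcup.
- exact: sigma_algebra_measurable.
move=> E [[A1 [A2 [mA1 mA2 ->]]]|nE].
  exists (A1 `*` A2); first exact: measurableX.
  by apply: eq_mod_refl; exact: negligible_set0.
by exists set0 => //; exists E => // x nEx; split.
Qed.

(** The projection to the outcomes is required to be null, so that a single null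
    set of outcomes serves for all values of the parameter in [T1]. *)
Definition cylinder_negligible (T1 : Type) (M : set (T1 * (Omega * Omega))) :=
  (P \x P)%E.-negligible (snd @` M).

Lemma cylinder_negligible_bigcup (T1 : Type)
    (F : (set (T1 * (Omega * Omega)))^nat) :
  (forall k, cylinder_negligible (F k)) -> cylinder_negligible (\bigcup_k F k).
Proof.
move=> nF; apply: (@negligibleS _ _ _ _ (\bigcup_k (snd @` F k))).
  by move=> _ [x [k _ Fx] <-]; exists k => //; exists x.
exact: negligible_bigcup.
Qed.

(** Over the product of [T1] with a completion, only the cylinders over completed
    events fail to be measurable for the uncompleted product, and each of them
    agrees with a measurable set off a null set of outcomes. *)
Lemma completed_product_version d1 (T1 : measurableType d1) (D : set T1)
    (c : T1 -> Omega -> Omega -> R) (K : R) :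
  measurable D -> 0 <= K -> (forall x w w', D x -> `|c x w w'| <= K) ->
  measurable_fun (D `*` setT)
    (fun p : T1 * g_sigma_algebraType (F2 P) => c p.1 p.2.1 p.2.2) ->
  exists g : T1 -> Omega -> Omega -> R, [/\
    measurable_fun setT (fun p : T1 * (Omega * Omega) => g p.1 p.2.1 p.2.2),
    (forall x w w', `|g x w w'| <= K), (forall x w w', ~ D x -> g x w w' = 0) &
    exists2 N, (P \x P)%E.-negligible N &
      forall w w', ~ N (w, w') -> forall x, D x -> g x w w' = c x w w'].
Proof.
move=> mD K0 cK mc.
have mDT : measurable (D `*` [set: Omega * Omega]) by exact: measurableX.
have [||g [mg gK g0 [M nM gM]]] := @measurable_version _ _ R
  (@cylinder_negligible T1) (@cylinder_negligible_bigcup T1) (D `*` setT)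
  (fun p => c p.1 p.2.1 p.2.2) K mDT K0.
- by move=> [x [w w']] [Dx _]; exact: cK.
- move=> q.
  have := mc (measurableX mD measurableT) _ (measurable_itv `]q, +oo[).
  set E := (X in measurable X) => mE.
  have [] := @generated_eq_mod (T1 * (Omega * Omega))%type
    (@cylinder_negligible T1) _ _ measurable _ _ _ E mE.
  + by rewrite /cylinder_negligible image_set0; exact: negligible_set0.
  + exact: cylinder_negligible_bigcup.
  + exact: sigma_algebra_measurable.
  + move=> _ [[A mA <-]|[A mA <-]]; rewrite setTI.
      exists (fst @^-1` A).
        by rewrite -[X in measurable X]setTI; exact: measurable_fst.
      by apply: eq_mod_refl;
        rewrite /cylinder_negligible image_set0; exact: negligible_set0.
    have FA : F2 P A.
      rewrite -(measurable_g_measurableTypeE (G := F2 P))//.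
      exact: smallest_sigma_algebra.
    have [B mB [N nN AB]] := F2_eq_mod FA.
    exists (snd @^-1` B).
      by rewrite -[X in measurable X]setTI; exact: measurable_snd.
    exists (setT `*` N).
      by apply: negligibleS nN => _ [[x w] [_ Nw] <-].
    by move=> [x w]/= nN'; apply: AB => Nw; exact: nN'.
  + move=> B mB EB; exists B => //.
    suff -> : [set x | (D `*` setT) x /\ q < c x.1 x.2.1 x.2.2] = E by [].
    apply/seteqP; split => [[x w]|[x w]]; rewrite /E/= in_itv/= andbT.
      by move=> [[]].
    by move=> [[]].
exists (fun x w w' => g (x, (w, w'))); split => //.
- by rewrite (_ : (fun p => _) = g)//; apply/funext => -[? []].
- by move=> x w w' nDx; apply: g0 => -[].
exists (snd @` M) => // w w' nMw x Dx.
rewrite gM//; by move=> Mx; apply: nMw; exists (x, (w, w')).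
Qed.

Lemma negligible_xsection (N : set (Omega * Omega)) :
  (P \x P)%E.-negligible N ->
  {ae P, forall w, P.-negligible [set w' | N (w, w')]}.
Proof.
move=> [M [mM M0 NM]].
have mMx : measurable_fun setT (fun w => P (xsection M w)).
  exact: measurable_fun_xsection.
have := @ae_eq_integral_abs _ _ _ P setT measurableT _ mMx.
under eq_integral do rewrite gee0_abs//.
move=> [H _]; have /H : (\int[P]_w (P (xsection M w)) = 0)%E by rewrite -[RHS]M0.
apply: filterS => w /(_ I) Mw.
apply: (negligibleS _ (A := xsection M w)).
  by move=> w' /= /NM ?; rewrite /xsection/= inE.
by apply/negligibleP => //; exact: measurable_xsection.
Qed.

Lemma negligible_ysection (N : set (Omega * Omega)) :
  (P \x P)%E.-negligible N ->
  {ae P, forall w, P.-negligible [set w' | N (w', w)]}.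
Proof.
move=> [M [mM M0 NM]].
have M0' : (P \x^ P)%E M = 0%E.
  rewrite -M0; apply/esym; apply: product_measure_unique => // A B mA mB.
  exact: product_measure2E.
have mMx : measurable_fun setT (fun w => P (ysection M w)).
  exact: measurable_fun_ysection.
have := @ae_eq_integral_abs _ _ _ P setT measurableT _ mMx.
under eq_integral do rewrite gee0_abs//.
move=> [H _]; have /H : (\int[P]_w (P (ysection M w)) = 0)%E by rewrite -[RHS]M0'.
apply: filterS => w /(_ I) Mw.
apply: (negligibleS _ (A := ysection M w)).
  by move=> w' /= /NM ?; rewrite /ysection/= inE.
by apply/negligibleP => //; exact: measurable_ysection.
Qed.

End completed_product.

(** * Moments of the centred normal law *)

Section normal_moments.
Context {R : realType}.
Variable s : R.
Hypothesis s_gt0 : 0 < s.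
Local Notation mu := (@lebesgue_measure R).
Local Notation p := (normal_pdf (0 : R) s).
Local Notation N := (@normal_prob R 0 s).

Let s_neq0 : s != 0. Proof. by rewrite gt_eqF. Qed.

Let pE x : p x = normal_peak s * expR (- (x ^+ 2 / (s ^+ 2 *+ 2))).
Proof. by rewrite normal_pdfE// /normal_fun subr0 mulNr. Qed.

Let p_even x : p (- x) = p x.
Proof. by rewrite !pE sqrrN. Qed.

Let derive_p (x : R) : is_derive x 1 (fun y : R => - s ^+ 2 * p y) (x * p x).
Proof.
rewrite (_ : (fun y => _) =
  (fun y => - s ^+ 2 * (normal_peak s * expR (- (y ^+ 2 / (s ^+ 2 *+ 2)))))).
  apply: is_derive_eq; rewrite pE scaler0 add0r /GRing.scale/= mulr1 -mulr2n.
  by field.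
by apply/funext => y; rewrite pE.
Qed.

Let cvg_p : p x @[x --> +oo] --> 0.
Proof.
rewrite (_ : p = fun x => normal_peak s *
    gauss_fun (x * (Num.sqrt (s ^+ 2 *+ 2))^-1)); last first.
  apply/funext => x; rewrite pE /gauss_fun exprMn exprVn sqr_sqrtr//.
  by rewrite mulrn_wge0// sqr_ge0.
rewrite -[X in _ --> X](mulr0 (normal_peak s)); apply: cvgM; first exact: cvg_cst.
apply: (cvg_comp _ _ _ cvg_gauss_fun).
apply/gt0_cvgMly; last exact: cvg_id.
by rewrite invr_gt0 sqrtr_gt0 pmulrn_lgt0// exprn_gt0.
Qed.

Let tail y : 0 <= y ->
  (\int[mu]_(x in `[y, +oo[) (x * p x)%:E = (s ^+ 2 * p y)%:E)%E.
Proof.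
move=> y0.
have dp x : derivable (fun y => - s ^+ 2 * p y) x 1.
  by apply: ex_derive; exact: derive_p.
rewrite (@ge0_continuous_FTC2y _ _ (fun y => - s ^+ 2 * p y) _ 0).
- by rewrite -EFinB mulNr opprK add0r.
- by move=> x yx; rewrite mulr_ge0 ?normal_pdf_ge0// (le_trans y0).
- apply: continuous_subspaceT => x; apply: cvgM; first exact: cvg_id.
  exact: continuous_normal_pdf.
- by rewrite -[X in _ --> X](mulr0 (- s ^+ 2)); apply: cvgM cvg_p; exact: cvg_cst.
- by move=> x _; exact: dp.
- apply: cvg_at_right_filter; apply: cvgM; first exact: cvg_cst.
  exact: continuous_normal_pdf.
- by move=> x _; rewrite derive1E; apply: derive_val; exact: derive_p.
Qed.

(** Writing [x ^ 2] as the integral of [x] over [y] in [0, x] and exchanging the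
    integrals leaves the tail integral of [x * p x], whose primitive is explicit. *)
Let half_second_moment :
  (\int[mu]_(x in `[0%R, +oo[) (x ^+ 2 * p x)%:E =
   (s ^+ 2)%:E * \int[mu]_(x in `[0%R, +oo[) (p x)%:E)%E.
Proof.
pose f (z : R * R) := (z.1 * p z.1 * (\1_`[0, z.1] z.2))%:E.
have f0 z : (0 <= f z)%E.
  rewrite lee_fin indicE; have [|_] := boolP (_ \in _); last by rewrite mulr0.
  rewrite inE/= in_itv/= => /andP[z0 z1].
  by rewrite mulr1 mulr_ge0 ?normal_pdf_ge0// (le_trans z0).
have mf : measurable_fun setT f.
  apply/measurable_EFinP; apply: measurable_funM.
    apply: measurable_funM => //.
    by apply: measurableT_comp => //; exact: measurable_normal_pdf.
  rewrite (_ : (fun z : R * R => _) =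
      \1_[set z : R * R | 0 <= z.2 /\ z.2 <= z.1]).
    apply: measurable_indic; apply: measurableI; exact: measurable_set_le.
  apply/funext => -[x y]; rewrite !indicE; congr (nat_of_bool _)%:R.
  by apply/idP/idP; rewrite !inE/= in_itv/= => /andP.
have <- : (\int[mu]_x \int[mu]_y f (x, y) =
    \int[mu]_(x in `[0%R, +oo[) (x ^+ 2 * p x)%:E)%E.
  rewrite [RHS]integral_mkcond; apply: eq_integral => x _.
  rewrite patchE/= mem_setE in_itv/= andbT; case: ifPn => x0.
    under eq_integral do rewrite /f/= EFinM.
    rewrite ge0_integralZl//; last first.
    - by rewrite lee_fin mulr_ge0 ?normal_pdf_ge0.
    - exact/measurable_EFinP.
    rewrite integral_indic// setIT.
    have mu0x : mu `[0%R, x]%classic = x%:E.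
      rewrite lebesgue_measure_itv/= lte_fin oppr0 adde0.
      by case: ltgtP x0 => // <-.
    transitivity ((x * p x)%:E * x%:E)%E; first by congr (_ * _)%E.
    by rewrite -EFinM; congr EFin; ring.
  transitivity (0 : \bar R)%E => //.
  rewrite -[RHS](integral0 mu setT); apply: eq_integral => y _.
  rewrite /f/= indicE memNset ?mulr0// /= in_itv/= => /andP[y0 yx].
  by move: x0; rewrite (le_trans y0 yx).
rewrite (@fubini_tonelli _ _ _ _ _ mu mu f mf f0).
rewrite -ge0_integralZl//; last 3 first.
- by apply/measurable_EFinP; apply: measurable_funTS; exact: measurable_normal_pdf.
- by move=> x _; rewrite lee_fin normal_pdf_ge0.
- by rewrite lee_fin sqr_ge0.
rewrite [RHS]integral_mkcond; apply: eq_integral => y _.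
rewrite patchE/= mem_setE in_itv/= andbT; case: ifPn => y0.
  rewrite -EFinM -tail// [RHS]integral_mkcond; apply: eq_integral => x _.
  rewrite patchE/= /f/= indicE mem_setE in_itv/= y0/= mem_setE in_itv/= andbT.
  by case: ifPn; rewrite ?mulr1 ?mulr0.
transitivity (0 : \bar R)%E => //.
rewrite -[RHS](integral0 mu setT); apply: eq_integral => x _.
by rewrite /f/= indicE memNset ?mulr0// /= in_itv/= (negbTE y0).
Qed.

Let even_integral (f : R -> R) : (forall x, 0 <= f x) -> continuous f ->
  (forall x, f (- x) = f x) ->
  (\int[mu]_x (f x)%:E = 2%:E * \int[mu]_(x in `[0%R, +oo[) (f x)%:E)%E.
Proof.
move=> f0 cf fN; rewrite ge0_symfun_integralT//; last by move=> x /=; rewrite fN.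
congr (_ * integral _ _ _)%E.
by apply/seteqP; split => x/=; rewrite in_itv/= andbT.
Qed.

Let second_moment_pdf : (\int[mu]_x (x ^+ 2 * p x)%:E = (s ^+ 2)%:E)%E.
Proof.
rewrite even_integral.
- rewrite half_second_moment muleCA -even_integral.
  + by rewrite integral_normal_pdf mule1.
  + by move=> x; exact: normal_pdf_ge0.
  + exact: continuous_normal_pdf.
  + exact: p_even.
- by move=> x; rewrite mulr_ge0 ?sqr_ge0 ?normal_pdf_ge0.
- move=> x; apply: cvgM; last exact: continuous_normal_pdf.
  exact: exprn_continuous.
- by move=> x; rewrite sqrrN p_even.
Qed.

(** The Radon-Nikodym derivative of the normal law is its density. *)
Lemma ge0_integral_normal_prob (f : R -> \bar R) : (forall x, 0 <= f x)%E ->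
  measurable_fun setT f ->
  (\int[N]_x f x = \int[mu]_x (f x * (p x)%:E))%E.
Proof.
move=> f0 mf.
have dom := normal_prob_dominates (0 : R) s.
rewrite -(Radon_Nikodym_SigmaFinite.change_of_variables dom)//.
have i_rn := Radon_Nikodym_SigmaFinite.f_integrable dom.
apply: ae_eq_integral => //.
- by apply: emeasurable_funM => //; exact: measurable_int i_rn.
- apply: emeasurable_funM => //; apply/measurable_EFinP.
  exact: measurable_normal_pdf.
apply: ae_eqe_mul2l; apply: integral_ae_eq => //.
  by apply/measurable_EFinP; exact: measurable_normal_pdf.
by move=> E _ mE; rewrite -Radon_Nikodym_SigmaFinite.f_integral.
Qed.

Lemma normal_prob_second_moment : (\int[N]_x (x ^+ 2)%:E = (s ^+ 2)%:E)%E.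
Proof.
rewrite ge0_integral_normal_prob.
- by rewrite -second_moment_pdf; apply: eq_integral => x _; rewrite EFinM.
- by move=> x; rewrite lee_fin sqr_ge0.
- by apply/measurable_EFinP.
Qed.

Lemma normal_prob_integrable_sqr : N.-integrable setT (fun x => (x ^+ 2)%:E).
Proof.
apply/integrableP; split; first exact/measurable_EFinP.
under eq_integral do rewrite gee0_abs ?lee_fin ?sqr_ge0//.
by rewrite normal_prob_second_moment ltry.
Qed.

Lemma normal_prob_integrable : N.-integrable setT (fun x : R => x%:E).
Proof.
have i2 : N.-integrable setT (fun x : R => (1 + x ^+ 2)%:E).
  have i1 : N.-integrable setT (EFin \o cst 1).
    exact: finite_measure_integrable_cst.
  exact: (integrableD measurableT i1 normal_prob_integrable_sqr).
apply: (le_integrable _ _ _ i2) => //; first exact/measurable_EFinP.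
move=> x _; rewrite /= lee_fin [leRHS]ger0_norm ?addr_ge0 ?sqr_ge0//.
by rewrite ler_norml; apply/andP; split; nra.
Qed.

Lemma normal_prob_mean : (\int[N]_x x%:E = 0)%E.
Proof.
have opp (g : R -> \bar R) : measurable_fun setT g -> (forall x, 0 <= g x)%E ->
    (\int[mu]_x g x = \int[mu]_x g (- x)%R)%E.
  move=> mg g0.
  transitivity (\int[pushforward mu (-%R : R -> measurableTypeR R)]_x g x)%E.
    by apply: eq_measure_integral => A mA _; exact/esym/lebesgue_measureN.
  by rewrite ge0_integral_pushforward// preimage_setT.
rewrite integralE.
suff -> : (\int[N]_x (EFin^\- x) = \int[N]_x (EFin^\+ x))%E.
  rewrite subee//; apply: integrable_fin_num => //; apply: integrable_funepos => //.
  exact: normal_prob_integrable.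
have mE : measurable_fun setT (EFin : R -> \bar R) by exact/measurable_EFinP.
have mp : measurable_fun setT (fun x => (p x)%:E).
  by apply/measurable_EFinP; exact: measurable_normal_pdf.
rewrite !ge0_integral_normal_prob//; last 2 first.
- exact: measurable_funepos.
- exact: measurable_funeneg.
rewrite opp.
- by apply: eq_integral => x _; rewrite p_even; congr (_ * _)%E;
    rewrite funenegE funeposE/= opprK.
- by apply: emeasurable_funM => //; exact: measurable_funeneg.
- by move=> x; rewrite mule_ge0 ?lee_fin ?normal_pdf_ge0.
Qed.

End normal_moments.

(** * Fubini for real-valued integrals, and independence *)

Section Fubini_real.
Context {R : realType} d1 d2 (T1 : measurableType d1) (T2 : measurableType d2).
Variables (m1 : {sigma_finite_measure set T1 -> \bar R})
          (m2 : {sigma_finite_measure set T2 -> \bar R}).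
Local Open Scope ereal_scope.

(** Unlike in the integrable case, the partial integrals of a function that is
    only measurable may be infinite; their real parts are measurable all the
    same. *)
Lemma measurable_Rintegral_snd (f : T1 * T2 -> R) : measurable_fun setT f ->
  measurable_fun setT (fun x => \int[m2]_y f (x, y))%R.
Proof.
move=> mf; apply: measurableT_comp => //.
have mEf : measurable_fun setT (EFin \o f) by exact/measurable_EFinP.
rewrite (_ : (fun x => _) = (fun x => \int[m2]_y (EFin \o f)^\+ (x, y) -
    \int[m2]_y (EFin \o f)^\- (x, y))).
  apply: emeasurable_funB.
  - apply: (measurable_fun_fubini_tonelli_F (m2 := m2)) => //.
    exact: measurable_funepos.
  - apply: (measurable_fun_fubini_tonelli_F (m2 := m2)) => //.
    exact: measurable_funeneg.
apply/funext => x; rewrite integralE.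
by congr (_ - _); apply: eq_integral => y _; rewrite ?funeposE ?funenegE.
Qed.

Lemma Rintegral_fubini (f : T1 * T2 -> R) :
  (m1 \x m2).-integrable setT (EFin \o f) ->
  (\int[m1 \x m2]_p f p = \int[m1]_x \int[m2]_y f (x, y))%R.
Proof.
move=> i_f; rewrite /Rintegral -integral12_prod_meas1//.
have mf : measurable_fun setT f by apply/measurable_EFinP; exact: measurable_int i_f.
congr fine; apply: ae_eq_integral => //.
- exact: (measurable_fubini_F i_f).
- by apply/measurable_EFinP; exact: measurable_Rintegral_snd.
have := ae_integrable1 i_f; apply: filterS => x ix _.
by rewrite fineK//; exact: integrable_fin_num.
Qed.

Lemma Rintegral_fubini_integrable (f : T1 * T2 -> R) :
  (m1 \x m2).-integrable setT (EFin \o f) ->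
  m1.-integrable setT (EFin \o (fun x => \int[m2]_y f (x, y))%R).
Proof.
move=> i_f.
have mf : measurable_fun setT f by apply/measurable_EFinP; exact: measurable_int i_f.
have /integrableP[mF F_int] := integrable_fubini_F i_f.
apply/integrableP; split.
  by apply/measurable_EFinP; exact: measurable_Rintegral_snd.
apply: le_lt_trans F_int; rewrite le_eqVlt; apply/orP; left; apply/eqP.
apply: ae_eq_integral => //.
- apply: measurableT_comp => //; apply/measurable_EFinP.
  exact: measurable_Rintegral_snd.
- exact: measurableT_comp.
have := ae_integrable1 i_f; apply: filterS => x ix _.
congr `|_|; rewrite /= /Rintegral fineK//; exact: integrable_fin_num.
Qed.

Lemma tensor_integral (f : T1 -> R) (g : T2 -> R) :
  m1.-integrable setT (EFin \o f) -> m2.-integrable setT (EFin \o g) ->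
  (m1 \x m2).-integrable setT (EFin \o (fun p => f p.1 * g p.2)%R) /\
  (\int[m1 \x m2]_p (f p.1 * g p.2) = (\int[m1]_x f x) * \int[m2]_y g y)%R.
Proof.
move=> i_f ig.
have mf : measurable_fun setT f by apply/measurable_EFinP; exact: measurable_int i_f.
have mg : measurable_fun setT g by apply/measurable_EFinP; exact: measurable_int ig.
have ifg : (m1 \x m2).-integrable setT (EFin \o (fun p => f p.1 * g p.2)%R).
  apply/integrable12ltyP.
    by apply/measurable_EFinP; apply: measurable_funM; exact: measurableT_comp.
  have ig1 := integrable_fin_num measurableT (integrable_abse ig).
  under eq_integral => x _.
    under eq_integral do rewrite /= normrM EFinM.
    rewrite ge0_integralZl//; last first.
      by apply/measurable_EFinP; exact: measurableT_comp.
    over.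
  rewrite -(fineK ig1) ge0_integralZr//.
  - rewrite lte_mul_pinfty ?ltry//; first exact: integral_ge0.
    by rewrite ge0_fin_numE ?integral_ge0//; have /integrableP[] := i_f.
  - by apply/measurable_EFinP; exact: measurableT_comp.
  - by rewrite lee_fin fine_ge0//; apply: integral_ge0 => x _; exact: abse_ge0.
split=> //; rewrite Rintegral_fubini//.
by under eq_Rintegral do rewrite /= RintegralZl//; rewrite RintegralZr.
Qed.

End Fubini_real.

Section independence.
Context {R : realType} {d : measure_display} {Omega : measurableType d}.
Variable P : probability Omega R.

(** Independence makes the joint law of [X] and [Y] the product of the marginal
    laws, so that the expectation of the product splits by Fubini. *)
Lemma independent_expectationM (X Y : {RV P >-> R}) :
  (forall A B : set R, measurable A -> measurable B ->
     P (X @^-1` A `&` Y @^-1` B) = (P (X @^-1` A) * P (Y @^-1` B))%E) ->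
  P.-integrable setT (EFin \o X) -> P.-integrable setT (EFin \o Y) ->
  P.-integrable setT (EFin \o (X \* Y)) /\
  \int[P]_w (X w * Y w) = (\int[P]_w X w) * (\int[P]_w Y w).
Proof.
move=> XY iX iY.
have mXY : measurable_fun setT (fun w => (X w, Y w)).
  exact: measurable_fun_pair.
pose Z : {RV P >-> (R * R)%type} := mfun_Sub (mem_set mXY).
have lawE A : measurable A ->
    (distribution P X \x distribution P Y)%E A = distribution P Z A.
  apply: product_measure_unique => B C mB mC.
  by rewrite /distribution/= /pushforward/= -XY.
have iX' : (distribution P X).-integrable setT (EFin \o id).
  apply: (@integrable_pushforward _ _ _ _ R X) => //.
  by apply/measurable_EFinP.
have iY' : (distribution P Y).-integrable setT (EFin \o id).
  apply: (@integrable_pushforward _ _ _ _ R Y) => //.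
  by apply/measurable_EFinP.
have [i_f f_int] := tensor_integral iX' iY'.
have mf := measurable_int _ i_f.
have iXY : P.-integrable setT (EFin \o (X \* Y)).
  apply/integrableP; split.
    by apply/measurable_EFinP; apply: measurable_funM.
  have [_] := integrableP _ _ _ i_f; apply: le_lt_trans.
  rewrite (eq_measure_integral (distribution P Z)); last by move=> A mA _; exact: lawE.
  by rewrite ge0_integral_distribution//; apply: measurableT_comp.
split=> //; move: f_int.
rewrite /Rintegral (eq_measure_integral (distribution P Z)); last first.
  by move=> A mA _; exact: lawE.
have iZ : P.-integrable setT
  ((EFin \o (fun p : R * R => id p.1 * id p.2)) \o Z) by [].
rewrite (integral_distribution mf iZ) /= => ->.
by congr (_ * _); congr fine; rewrite integral_distribution//;
  apply/measurable_EFinP.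
Qed.

Lemma measure_eq_mod (A B : set Omega) :
  measurable A -> measurable B -> eq_mod P.-negligible A B -> P A = P B.
Proof.
move=> mA mB [M [N [mN N0 MN]] AB].
have PI C : measurable C -> P C = P (C `\` N).
  move=> mC; rewrite (measureDI P mC mN).
  rewrite (@subset_measure0 _ _ _ P (C `&` N) N) ?adde0//.
  exact: measurableI.
rewrite PI// [RHS]PI//; congr (P _).
apply/seteqP; split => x [Cx nNx]; split => //; by apply/AB => // /MN.
Qed.

End independence.

(** * Brownian increments and the augmented filtration *)

Section augmented_filtration.
Context {R : realType} {d : measure_display} {Omega : measurableType d}.
Variables (P : probability Omega R) (W : R -> {RV P >-> R}).
Hypothesis P_complete : measure_is_complete P.

Lemma natural_filtration_measurable t A :
  natural_filtration W t A -> measurable A.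
Proof.
move: A; apply: smallest_sub; first exact: sigma_algebra_measurable.
by move=> _ [u [B [_ mB ->]]]; exact: measurable_funPTI.
Qed.

Lemma filt_sub_measurable t : filt W t `<=` measurable.
Proof.
apply: smallest_sub; first exact: sigma_algebra_measurable.
by move=> A [/natural_filtration_measurable|/P_complete].
Qed.

Lemma filt_sigmaE t : (filt W t).-sigma.-measurable = filt W t.
Proof. exact/measurable_g_measurableTypeE/smallest_sigma_algebra. Qed.

Lemma filt_mono s t : s <= t -> filt W s `<=` filt W t.
Proof.
move=> st; apply: sub_sigma_algebra2 => A [nA|nA]; [left|by right].
move: A nA; apply: sub_sigma_algebra2 => A [u [B [/andP[u0 us] mB ->]]].
by exists u, B; split => //; rewrite u0 (le_trans us).
Qed.

Lemma filt_fun_mono s t (f : Omega -> R) : s <= t ->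
  measurable_fun setT (f : g_sigma_algebraType (filt W s) -> R) ->
  measurable_fun setT (f : g_sigma_algebraType (filt W t) -> R).
Proof.
move=> st mf _ B mB; rewrite filt_sigmaE; apply: (filt_mono st).
by rewrite -filt_sigmaE; exact: mf.
Qed.

Lemma filt_fun_measurable t (f : Omega -> R) :
  measurable_fun setT (f : g_sigma_algebraType (filt W t) -> R) ->
  measurable_fun setT f.
Proof.
move=> mf _ B mB; apply: (filt_sub_measurable (t := t)).
by rewrite -filt_sigmaE; exact: mf.
Qed.

Lemma filt_fun_brownian u t : 0 <= u <= t ->
  measurable_fun setT (W u : g_sigma_algebraType (filt W t) -> R).
Proof.
move=> ut _ B mB; rewrite setTI filt_sigmaE.
by apply: sub_sigma_algebra; left; apply: sub_sigma_algebra; exists u, B.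
Qed.

Hypothesis W_brownian : brownian_motion W.

(** An event of the augmented filtration differs from one of the natural
    filtration by a null set, which affects no probability. *)
Lemma increment_independent_filt (s t : R) (A : set Omega) (B : set R) :
  0 <= s < t -> filt W s A -> measurable B ->
  P (A `&` (W t \- W s) @^-1` B) = (P A * P ((W t \- W s)%R @^-1` B))%E.
Proof.
move=> st sA mB.
have mD : measurable ((W t \- W s) @^-1` B).
  by rewrite -[X in measurable X]setTI; exact: measurable_funB.
have [A' A'nat AA'] : exists2 A', natural_filtration W s A' &
    eq_mod P.-negligible A A'.
  apply: generated_eq_mod sA.
  - exact: negligible_set0.
  - exact: negligible_bigcup.
  - exact: smallest_sigma_algebra.
  move=> E [nE|nE].
    by exists E => //; apply: eq_mod_refl; exact: negligible_set0.
  exists set0; first exact: sigma_algebra0.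
  by exists E => // x nEx; split.
have mA : measurable A by exact: filt_sub_measurable sA.
have mA' : measurable A' by exact: natural_filtration_measurable A'nat.
have [_ _ _ indep] := W_brownian.
rewrite (measure_eq_mod mA mA' AA') -indep//; apply: measure_eq_mod.
- exact: measurableI.
- exact: measurableI.
have [M nM AM] := AA'; exists M => // x /AM Ax.
by split => -[/Ax Ax' Dx].
Qed.

End augmented_filtration.

Section brownian_increments.
Context {R : realType} {d : measure_display} {Omega : measurableType d}.
Variables (P : probability Omega R) (W : R -> {RV P >-> R}).
Hypothesis P_complete : measure_is_complete P.
Hypothesis W_brownian : brownian_motion W.

Lemma increment_moments (s t : R) : 0 <= s <= t ->
  [/\ P.-integrable setT (EFin \o (W t \- W s)),
      P.-integrable setT (EFin \o (fun w => (W t w - W s w) ^+ 2)),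
      \int[P]_w (W t w - W s w) = 0 &
      \int[P]_w (W t w - W s w) ^+ 2 = t - s].
Proof.
move=> /andP[s0]; rewrite le_eqVlt => /predU1P[->|st].
  have e : W t \- W t = cst 0 by apply/funext => w /=; rewrite subrr.
  have e2 : (fun w => (W t w - W t w) ^+ 2) = cst 0.
    by apply/funext => w /=; rewrite subrr expr0n.
  rewrite e2; split.
  - by rewrite e; exact: finite_measure_integrable_cst.
  - exact: finite_measure_integrable_cst.
  - rewrite (_ : (fun w => W t w - W t w) = cst 0)//.
    by rewrite Rintegral_cst// mul0r.
  - by rewrite Rintegral_cst// mul0r subrr.
pose sg := Num.sqrt (t - s).
have ts0 : 0 < t - s by rewrite subr_gt0.
have sg0 : 0 < sg by rewrite sqrtr_gt0.
have sg2 : sg ^+ 2 = t - s by rewrite sqr_sqrtr// ltW.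
have mD : @measurable_fun _ _ Omega (measurableTypeR R) setT (W t \- W s).
  exact: measurable_funB.
pose D : {RV P >-> measurableTypeR R} :=
  @mfun_Sub _ _ Omega (measurableTypeR R) _ (mem_set mD).
have lawD A : measurable A -> distribution P D A = normal_prob 0 sg A.
  move=> mA; have [_ _ gauss _] := W_brownian.
  by rewrite -gauss// s0.
have law_int (f : R -> \bar R) :
    (\int[distribution P D]_x f x = \int[normal_prob 0 sg]_x f x)%E.
  by apply: eq_measure_integral => A mA _; exact: lawD.
have iD2 : P.-integrable setT (EFin \o (fun w => (W t w - W s w) ^+ 2)).
  apply/integrableP; split.
    by apply/measurable_EFinP; apply: measurable_funX.
  rewrite (_ : \int[P]_x _ = \int[distribution P D]_x `|(x ^+ 2)%:E|)%E; last first.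
    rewrite ge0_integral_distribution//.
    apply: measurableT_comp => //; exact/measurable_EFinP.
  rewrite law_int.
  by have /integrableP[] := normal_prob_integrable_sqr sg0.
have iD : P.-integrable setT (EFin \o (W t \- W s)).
  have i1 : P.-integrable setT (EFin \o cst 1).
    exact: finite_measure_integrable_cst.
  apply: (le_integrable _ _ _ (integrableD measurableT i1 iD2)) => //.
    exact/measurable_EFinP.
  move=> x _; rewrite /= lee_fin [leRHS]ger0_norm ?addr_ge0 ?sqr_ge0//.
  by move: (W t x - W s x) => y; rewrite ler_norml; apply/andP; split; nra.
split => //; rewrite /Rintegral.
- have -> : (\int[P]_w (W t w - W s w)%:E = \int[distribution P D]_x x%:E)%E.
    by rewrite integral_distribution//; exact/measurable_EFinP.
  rewrite law_int.
  by rewrite normal_prob_mean.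
- have -> : (\int[P]_w ((W t w - W s w) ^+ 2)%:E =
             \int[distribution P D]_x (x ^+ 2)%:E)%E.
    by rewrite integral_distribution//; exact/measurable_EFinP.
  rewrite law_int.
  by rewrite normal_prob_second_moment.
Qed.

Section past.
Variables (s t : R) (f : Omega -> R).
Hypothesis st : 0 <= s <= t.
Hypothesis f_past :
  measurable_fun setT (f : g_sigma_algebraType (filt W s) -> R).
Hypothesis f_int : P.-integrable setT (EFin \o f).

Lemma expectation_past_increment_comp (g : R -> R) : measurable_fun setT g ->
  P.-integrable setT (EFin \o (fun w => g (W t w - W s w))) ->
  P.-integrable setT (EFin \o (fun w => f w * g (W t w - W s w))) /\
  \int[P]_w (f w * g (W t w - W s w)) =
    (\int[P]_w f w) * \int[P]_w g (W t w - W s w).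
Proof.
move=> mg ig.
have mf : measurable_fun setT f by exact: filt_fun_measurable f_past.
have mgD : measurable_fun setT (fun w => g (W t w - W s w)).
  by apply: measurableT_comp => //; exact: measurable_funB.
pose X : {RV P >-> R} := mfun_Sub (mem_set mf).
pose Y : {RV P >-> R} := mfun_Sub (mem_set mgD).
apply: (@independent_expectationM _ _ _ P X Y) => // A B mA mB /=.
have sA : filt W s (f @^-1` A).
  by rewrite -filt_sigmaE -[X in measurable X]setTI; exact: f_past.
have mgB : measurable (g @^-1` B) by rewrite -[X in measurable X]setTI; exact: mg.
have [/andP[s0]] := st; rewrite le_eqVlt => /predU1P[ts|ltst]; last first.
  by apply: (increment_independent_filt _ _ _ sA mgB) => //; rewrite s0.
have D0 w : W t w - W s w = 0 by rewrite ts subrr.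
have [g0B|g0B] := pselect (B (g 0)).
  rewrite (_ : (fun w => _) @^-1` B = setT).
    by rewrite setIT probability_setT mule1.
  by apply/seteqP; split => // w _ /=; rewrite D0.
rewrite (_ : (fun w => _) @^-1` B = set0).
  by rewrite setI0 measure0 mule0.
by apply/seteqP; split => // w /=; rewrite D0.
Qed.

(** Independence splits the expectation, and the increment has mean zero. *)
Lemma expectation_past_increment :
  P.-integrable setT (EFin \o (fun w => f w * (W t w - W s w))) /\
  \int[P]_w (f w * (W t w - W s w)) = 0.
Proof.
have [iD _ D0 _] := increment_moments st.
have [? ->] := expectation_past_increment_comp (g := id) (@measurable_id _ _ _) iD.
by rewrite D0 mulr0.
Qed.

Lemma expectation_past_increment_sqr :
  P.-integrable setT (EFin \o (fun w => f w * (W t w - W s w) ^+ 2)) /\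
  \int[P]_w (f w * (W t w - W s w) ^+ 2) = (\int[P]_w f w) * (t - s).
Proof.
have [_ iD2 _ D2] := increment_moments st.
have [? ->] := expectation_past_increment_comp (g := fun x => x ^+ 2)
  (measurable_funX 2 (@measurable_id _ _ _)) iD2.
by rewrite D2.
Qed.

End past.

End brownian_increments.

(** * Square-integrable functions *)

Section square_integrable.
Context d (T : measurableType d) (R : realType).
Variable m : {measure set T -> \bar R}.
Implicit Types f g : T -> R.
Local Notation L2 := (Lfun m 2%:E).

Lemma Lfun2_measurable f : f \in L2 -> measurable_fun setT f.
Proof. by rewrite inE => /andP[/[!inE]]. Qed.

Lemma Lfun2P f : f \in L2 <->
  measurable_fun setT f /\ (\int[m]_x (f x ^+ 2)%:E < +oo)%E.
Proof.
split=> [fL2|[mf f2]].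
  split; first exact: Lfun2_measurable.
  exact/integrable_lty/Lfun2_integrable_sqr.
rewrite inE; apply/andP; split; rewrite inE//=.
rewrite /finite_norm unlock/=.
apply: poweR_lty; apply: le_lt_trans f2.
by under eq_integral do rewrite -[2]/(2%:R) powR_mulrn// -normrX ger0_norm ?sqr_ge0//.
Qed.

Lemma Lfun2_dominated f g : measurable_fun setT f ->
  m.-integrable setT (EFin \o g) -> (forall x, f x ^+ 2 <= g x) -> f \in L2.
Proof.
move=> mf ig fg; apply/Lfun2P; split => //.
have /integrableP[_] := ig; apply: le_lt_trans.
apply: ge0_le_integral => //.
- by move=> x _; rewrite lee_fin sqr_ge0.
- by apply/measurable_EFinP; exact: measurable_funX.
- by apply: measurableT_comp => //; exact: measurable_int ig.
- by move=> x _; rewrite /= lee_fin (le_trans (fg x))// ler_norm.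
Qed.

Lemma Lfun2_mul_integrable f g : f \in L2 -> g \in L2 ->
  m.-integrable setT (EFin \o (fun x => f x * g x)).
Proof. by move=> fL gL; apply/Lfun1_integrable; exact: Lfun2_mul_Lfun1. Qed.

Lemma Lfun2D f g : f \in L2 -> g \in L2 -> (fun x => f x + g x) \in L2.
Proof.
move=> fL gL; apply: (@Lfun2_dominated _ (fun x => 2 * (f x ^+ 2 + g x ^+ 2))).
- by apply: measurable_funD; exact: Lfun2_measurable.
- have := integrableZl measurableT 2 (integrableD measurableT
    (Lfun2_integrable_sqr fL) (Lfun2_integrable_sqr gL)).
  by apply: eq_integrable => // x _; rewrite /= EFinM EFinD.
- by move=> x; have := sqr_ge0 (f x - g x); lra.
Qed.

Lemma Lfun2Z (c : R) f : f \in L2 -> (fun x => c * f x) \in L2.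
Proof.
move=> fL; apply: (@Lfun2_dominated _ (fun x => c ^+ 2 * f x ^+ 2)).
- by apply: measurable_funM => //; exact: Lfun2_measurable.
- have := integrableZl measurableT (c ^+ 2) (Lfun2_integrable_sqr fL).
  by apply: eq_integrable => // x _; rewrite /= EFinM.
- by move=> x; rewrite exprMn.
Qed.

Lemma Lfun2B f g : f \in L2 -> g \in L2 -> (fun x => f x - g x) \in L2.
Proof.
move=> fL gL; under eq_fun do rewrite -mulN1r.
by apply: Lfun2D => //; exact: Lfun2Z.
Qed.

Lemma Lfun2_0 : (fun=> 0) \in L2.
Proof.
apply/Lfun2P; split => //.
under eq_integral do rewrite expr0n/=.
by rewrite integral0 ltry.
Qed.

Lemma Lfun2_sum (I : Type) (r : seq I) (Q : pred I) (F : I -> T -> R) :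
  (forall i, Q i -> F i \in L2) -> (fun x => \sum_(i <- r | Q i) F i x) \in L2.
Proof.
move=> FL; elim: r => [|i r ih].
  by under eq_fun do rewrite big_nil; exact: Lfun2_0.
case Qi : (Q i); under eq_fun do rewrite big_cons Qi; last exact: ih.
by apply: Lfun2D => //; exact: FL.
Qed.

Lemma Lfun2_bounded_mul (K : R) (b : T -> R) f : measurable_fun setT b ->
  (forall x, `|b x| <= K) -> f \in L2 -> (fun x => b x * f x) \in L2.
Proof.
move=> mb bK fL.
apply: (@Lfun2_dominated _ (fun x => K ^+ 2 * f x ^+ 2)).
- by apply: measurable_funM => //; exact: Lfun2_measurable.
- have := integrableZl measurableT (K ^+ 2) (Lfun2_integrable_sqr fL).
  by apply: eq_integrable => // x _; rewrite /= EFinM.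
- move=> x; rewrite exprMn ler_wpM2r ?sqr_ge0//.
  by rewrite -[leLHS]real_normK ?num_real// ler_sqr ?nnegrE// (le_trans _ (bK x)).
Qed.

Lemma Rintegral_ae_eq f g : measurable_fun setT f -> measurable_fun setT g ->
  {ae m, forall x, f x = g x} -> \int[m]_x f x = \int[m]_x g x.
Proof.
move=> mf mg fg; congr fine; apply: ae_eq_integral => //.
- exact/measurable_EFinP.
- exact/measurable_EFinP.
- by apply: filterS fg => x -> _.
Qed.

Lemma Lfun2_ae_eq f g : f \in L2 -> measurable_fun setT g ->
  {ae m, forall x, f x = g x} -> g \in L2.
Proof.
move=> /Lfun2P[mf f2] mg fg; apply/Lfun2P; split => //.
apply: le_lt_trans f2; rewrite le_eqVlt; apply/orP; left; apply/eqP.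
apply: ae_eq_integral => //.
- by apply/measurable_EFinP; exact: measurable_funX.
- by apply/measurable_EFinP; exact: measurable_funX.
- by apply: filterS fg => x -> _.
Qed.

Lemma cauchy_schwarz f g : f \in L2 -> g \in L2 ->
  `|\int[m]_x (f x * g x)| <=
    Num.sqrt (\int[m]_x f x ^+ 2) * Num.sqrt (\int[m]_x g x ^+ 2).
Proof.
move=> fL gL.
set A := \int[m]_x f x ^+ 2; set B := \int[m]_x (f x * g x).
set C := \int[m]_x g x ^+ 2.
have A0 : 0 <= A by apply: Rintegral_ge0 => x _; exact: sqr_ge0.
have C0 : 0 <= C by apply: Rintegral_ge0 => x _; exact: sqr_ge0.
have if2 := Lfun2_integrable_sqr fL; have ig2 := Lfun2_integrable_sqr gL.
have ifg := Lfun2_mul_integrable fL gL.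
have quad r : 0 <= A + (2 * r * B + r ^+ 2 * C).
  have : 0 <= \int[m]_x (f x ^+ 2 + (2 * r * (f x * g x) + r ^+ 2 * g x ^+ 2)).
    apply: Rintegral_ge0 => x _.
    rewrite (_ : _ + _ = (f x + r * g x) ^+ 2) ?sqr_ge0//; ring.
  have iB : m.-integrable setT (EFin \o (fun x => 2 * r * (f x * g x))).
    have := integrableZl measurableT (2 * r) ifg.
    by apply: eq_integrable => // x _; rewrite /= EFinM.
  have iC : m.-integrable setT (EFin \o (fun x => r ^+ 2 * g x ^+ 2)).
    have := integrableZl measurableT (r ^+ 2) ig2.
    by apply: eq_integrable => // x _; rewrite /= EFinM.
  have iBC : m.-integrable setT
      (EFin \o (fun x => 2 * r * (f x * g x) + r ^+ 2 * g x ^+ 2)).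
    have := integrableD measurableT iB iC.
    by apply: eq_integrable => // x _; rewrite /= EFinD.
  by rewrite RintegralD// RintegralD// RintegralZl// RintegralZl.
have BAC : B ^+ 2 <= A * C.
  have [C1|C1] := eqVneq C 0.
    have [->|B0] := eqVneq B 0; first by rewrite expr0n/= mulr_ge0.
    have := quad (- (A + 1) / (2 * B)); rewrite C1 mulr0 addr0.
    rewrite (_ : 2 * _ * B = - (A + 1)); last by field.
    by rewrite opprD addrA subrr sub0r oppr_ge0 ler10.
  have := quad (- B / C).
  rewrite (_ : A + _ = (A * C - B ^+ 2) / C); last by field.
  by rewrite pmulr_lge0 ?subr_ge0// invr_gt0 lt_neqAle eq_sym C1.
rewrite -sqrtr_sqr -sqrtrM// ler_sqrt//.
by rewrite mulr_ge0.
Qed.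

End square_integrable.

Section L2_convergence.
Context d (T : measurableType d) (R : realType).
Variable m : {measure set T -> \bar R}.
Local Notation L2 := (Lfun m 2%:E).

Definition L2_cvg (h : nat -> T -> R) (f : T -> R) :=
  (fun k => \int[m]_x ((f x - h k x) ^+ 2)%:E)%E @ \oo --> 0%E.

Lemma L2_cvg_Lfun2 h f : (forall k, h k \in L2) -> measurable_fun setT f ->
  L2_cvg h f -> f \in L2.
Proof.
move=> hL mf hf.
have : \forall k \near \oo, (\int[m]_x ((f x - h k x) ^+ 2)%:E < 1)%E.
  apply: (hf [set y | (y < 1)%E]); apply: open_nbhs_nbhs.
  by split; [exact: open_ereal_lt_ereal|exact: lte01].
move=> [k _ /(_ k (leqnn k))/= dk].
have dL : (fun x => f x - h k x) \in L2.
  apply/Lfun2P; split; last by apply: lt_trans dk _; rewrite ltry.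
  by apply: measurable_funB => //; exact: Lfun2_measurable (hL k).
rewrite (_ : f = fun x => (f x - h k x) + h k x); first exact: Lfun2D (hL k).
by apply/funext => x; rewrite subrK.
Qed.

Lemma L2_cvg_sqrt h f : (forall k, h k \in L2) -> f \in L2 -> L2_cvg h f ->
  Num.sqrt (\int[m]_x (f x - h k x) ^+ 2) @[k --> \oo] --> 0.
Proof.
move=> hL fL hf; rewrite -[X in _ --> X]sqrtr0.
apply: continuous_cvg; first exact: sqrt_continuous.
apply: fine_cvg.
exact: hf.
Qed.

(** The error is the sum of three inner products in which at least one factor
    tends to zero, to be bounded by the Cauchy-Schwarz inequality. *)
Lemma L2_cvg_inner h f k g : (forall i, h i \in L2) -> (forall i, k i \in L2) ->
  measurable_fun setT f -> measurable_fun setT g -> L2_cvg h f -> L2_cvg k g ->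
  \int[m]_x (h i x * k i x) @[i --> \oo] --> \int[m]_x (f x * g x).
Proof.
move=> hL kL mf mg hf kg.
have fL := L2_cvg_Lfun2 hL mf hf; have gL := L2_cvg_Lfun2 kL mg kg.
pose a i := Num.sqrt (\int[m]_x (f x - h i x) ^+ 2).
pose b i := Num.sqrt (\int[m]_x (g x - k i x) ^+ 2).
pose F := Num.sqrt (\int[m]_x f x ^+ 2).
pose G := Num.sqrt (\int[m]_x g x ^+ 2).
have a0 : a i @[i --> \oo] --> 0 by exact: L2_cvg_sqrt.
have b0 : b i @[i --> \oo] --> 0 by exact: L2_cvg_sqrt.
apply/cvgrPdist_le => /= e e0.
have abG : F * b i + (a i * G + a i * b i) @[i --> \oo] --> 0.
  rewrite (_ : 0 = F * 0 + (0 * G + 0 * 0)); last by ring.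
  apply: cvgD; first by apply: cvgM => //; exact: cvg_cst.
  by apply: cvgD; apply: cvgM => //; exact: cvg_cst.
move/cvgrPdist_le : abG => /(_ e e0); apply: filterS => i /=.
rewrite sub0r normrN ger0_norm; last first.
  by rewrite !addr_ge0// mulr_ge0// sqrtr_ge0.
apply: le_trans.
have dfL : (fun x => f x - h i x) \in L2 by exact: Lfun2B.
have dgL : (fun x => g x - k i x) \in L2 by exact: Lfun2B.
have i1 := Lfun2_mul_integrable fL dgL.
have i2 := Lfun2_mul_integrable dfL gL.
have i3 := Lfun2_mul_integrable dfL dgL.
have i4 := Lfun2_mul_integrable fL gL.
have i5 := Lfun2_mul_integrable (hL i) (kL i).
have -> : \int[m]_x (f x * g x) - \int[m]_x (h i x * k i x) =
    \int[m]_x (f x * (g x - k i x)) + (\int[m]_x ((f x - h i x) * g x) -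
      \int[m]_x ((f x - h i x) * (g x - k i x))).
  have i23 : m.-integrable setT (EFin \o (fun x => (f x - h i x) * g x -
      (f x - h i x) * (g x - k i x))).
    have := integrableB measurableT i2 i3.
    by apply: eq_integrable => // x _; rewrite /= EFinB.
  rewrite -!RintegralB// -RintegralD//; apply: eq_Rintegral => x _; ring.
apply: (le_trans (ler_normD _ _)); apply: lerD; first exact: cauchy_schwarz.
apply: (le_trans (ler_normB _ _)).
by apply: lerD; exact: cauchy_schwarz.
Qed.

End L2_convergence.

(** * The Ito integral: isometry and orthogonality to the past *)

Section Rintegral_sums.
Context d (T : measurableType d) (R : realType).
Variable m : {measure set T -> \bar R}.

Lemma Rintegral_sum (I : Type) (r : seq I) (F : I -> T -> R) :
  (forall i, m.-integrable setT (EFin \o F i)) ->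
  m.-integrable setT (EFin \o (fun x => \sum_(i <- r) F i x)) /\
  \int[m]_x (\sum_(i <- r) F i x) = \sum_(i <- r) \int[m]_x F i x.
Proof.
move=> iF; elim: r => [|i r [ir Ir]].
  split; last by under eq_Rintegral do rewrite big_nil;
    rewrite big_nil /Rintegral integral0.
  by rewrite /comp; under eq_fun do rewrite big_nil; exact: integrable0.
split.
  rewrite /comp; under eq_fun do rewrite big_cons EFinD.
  exact: (integrableD measurableT (iF i) ir).
under eq_Rintegral do rewrite big_cons.
by rewrite big_cons RintegralD// Ir.
Qed.

End Rintegral_sums.

Section interval_overlap.
Context {R : realType}.
Local Notation mu := (@lebesgue_measure R).
Implicit Types s t u v : R.

Definition overlap s t u v : R := \int[mu]_r (\1_`]s, t] r * \1_`]u, v] r).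

Lemma indic_itv_integrable s t : mu.-integrable setT (EFin \o \1_`]s, t]).
Proof. exact: (@integrable_indic_itv R s t false false). Qed.

Lemma overlapC s t u v : overlap s t u v = overlap u v s t.
Proof. by apply: eq_Rintegral => r _; rewrite mulrC. Qed.

Lemma overlapE s t u v : s <= u -> u <= v -> u <= t ->
  overlap s t u v = Num.min t v - u.
Proof.
move=> su uv ut.
rewrite /overlap (_ : (fun r => _) = \1_`]u, Num.min t v]); last first.
  apply/funext => r; rewrite !indicE !mem_setE !in_itv/= le_min.
  case: (ltP u r) => ur /=; rewrite ?mulr0//.
  by rewrite (le_lt_trans su ur)/=; do 2 case: leP => _; rewrite ?mulr0 ?mulr1 ?mul0r.
have len : mu `]u, Num.min t v]%classic = (Num.min t v - u)%:E.
  rewrite lebesgue_measure_itv/= lte_fin; case: ltP => // minu.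
  have -> : Num.min t v = u by apply/eqP; rewrite eq_le minu le_min ut uv.
  by rewrite subrr.
by rewrite /Rintegral integral_indic// setIT; exact: (congr1 fine len).
Qed.

Lemma overlap_disjoint s t u v : t <= u -> overlap s t u v = 0.
Proof.
move=> tu; rewrite /overlap (_ : (fun r => _) = cst 0).
  by rewrite /Rintegral integral0.
apply/funext => r; rewrite !indicE !mem_setE !in_itv/=.
case: (ltP u r) => ur /=; rewrite ?mulr0//.
by rewrite (leNgt r t) (le_lt_trans tu ur)/= andbF mul0r.
Qed.

End interval_overlap.

Section simple_isometry.
Context {R : realType} {d : measure_display} {Omega : measurableType d}.
Variables (P : probability Omega R) (W : R -> {RV P >-> R}).
Hypothesis P_complete : measure_is_complete P.
Hypothesis W_brownian : brownian_motion W.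
Local Notation L2 := (Lfun P 2%:E).
Local Notation mu := (@lebesgue_measure R).

Definition past (s : R) (f : Omega -> R) :=
  measurable_fun setT (f : g_sigma_algebraType (filt W s) -> R).

Definition bounded_past (s : R) (f : Omega -> R) :=
  past s f /\ exists K, forall w, `|f w| <= K.

Lemma past_mono s t f : s <= t -> past s f -> past t f.
Proof. exact: filt_fun_mono. Qed.

Lemma bounded_past_mono s t f : s <= t -> bounded_past s f -> bounded_past t f.
Proof. by move=> st [pf bf]; split => //; exact: past_mono pf. Qed.

Lemma bounded_pastM s f g : bounded_past s f -> bounded_past s g ->
  bounded_past s (fun w => f w * g w).
Proof.
move=> [pf [K fK]] [pg [L gL]]; split; first exact: measurable_funM.
by exists (K * L) => w; rewrite normrM ler_pM.
Qed.

Lemma past_measurable s f : past s f -> measurable_fun setT f.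
Proof. exact: filt_fun_measurable. Qed.

Lemma past_increment s t u : 0 <= s -> s <= t -> t <= u ->
  past u (fun w => W t w - W s w).
Proof.
move=> s0 st tu; apply: measurable_funB; apply: filt_fun_brownian.
  by rewrite (le_trans s0 st).
by rewrite s0 (le_trans st tu).
Qed.

Lemma increment_Lfun2 s t : 0 <= s <= t -> (fun w => W t w - W s w) \in L2.
Proof.
move=> st; apply/Lfun2P; split; first exact: measurable_funB.
by have [_ /integrable_lty + _ _] := increment_moments W_brownian st; exact.
Qed.

Lemma bounded_past_Lfun2M s f g : bounded_past s f -> g \in L2 ->
  (fun w => f w * g w) \in L2.
Proof.
move=> [pf [K fK]]; apply: (@Lfun2_bounded_mul _ _ _ _ K) => //.
exact: past_measurable pf.
Qed.

Lemma bounded_past_integrable s f : bounded_past s f ->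
  P.-integrable setT (EFin \o f).
Proof.
move=> [pf [K fK]]; apply: (le_integrable measurableT _ _
  (finite_measure_integrable_cst P K measurableT)).
  by apply/measurable_EFinP; exact: past_measurable pf.
by move=> w _; rewrite /= lee_fin (le_trans (fK w))// ler_norm.
Qed.

Lemma expectation_disjoint_increments s t u v f : 0 <= s -> s <= t -> t <= u ->
  u <= v -> bounded_past u f ->
  \int[P]_w (f w * ((W t w - W s w) * (W v w - W u w))) = 0.
Proof.
move=> s0 st tu uv bf; under eq_Rintegral do rewrite mulrA.
have u0 : 0 <= u by rewrite (le_trans s0)// (le_trans st).
have [|||_ //] := expectation_past_increment P_complete W_brownian
  (f := fun w => f w * (W t w - W s w)) (s := u) (t := v).
- by rewrite u0.
- by apply: measurable_funM; [case: bf|exact: past_increment].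
- have [pf [K fK]] := bf.
  have st0 : 0 <= s <= t by rewrite s0.
  have [iD _ _ _] := increment_moments W_brownian st0.
  have := @integrableMr _ _ _ P setT measurableT f (EFin \o (W t \- W s))
    (past_measurable pf) _ iD.
  apply; exists K; split; first exact: num_real.
  by move=> x Kx w _; exact: le_trans (fK w) (ltW Kx).
Qed.

Lemma bounded_increments_integrable r s t u v f : bounded_past r f ->
  0 <= s <= t -> 0 <= u <= v ->
  P.-integrable setT
    (EFin \o (fun w => f w * ((W t w - W s w) * (W v w - W u w)))).
Proof.
move=> bf st uv; rewrite /comp; under eq_fun do rewrite mulrA.
apply: Lfun2_mul_integrable; last exact: increment_Lfun2.
by apply: bounded_past_Lfun2M bf _; exact: increment_Lfun2.
Qed.

Lemma expectation_same_start u t v f : 0 <= u -> u <= t -> t <= v ->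
  bounded_past u f ->
  \int[P]_w (f w * ((W t w - W u w) * (W v w - W u w))) =
    (\int[P]_w f w) * (t - u).
Proof.
move=> u0 ut tv bf.
have ut0 : 0 <= u <= t by rewrite u0.
have tv0 : 0 <= t <= v by rewrite tv (le_trans u0).
have [i2 <-] := expectation_past_increment_sqr P_complete W_brownian ut0
  bf.1 (bounded_past_integrable bf).
rewrite -[RHS]addr0 -(@expectation_disjoint_increments u t t v f)//; last first.
  exact: bounded_past_mono bf.
rewrite -RintegralD//; last exact: bounded_increments_integrable bf _ _.
by apply: eq_Rintegral => w _; ring.
Qed.

(** Two increments only correlate through the overlap of their time intervals:
    cutting both at the later starting point and at the earlier end point leaves
    one squared increment, the other products having mean zero. *)
Lemma expectation_increments s t u v f g : 0 <= s <= t -> 0 <= u <= v ->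
  bounded_past s f -> bounded_past u g ->
  \int[P]_w (f w * g w * ((W t w - W s w) * (W v w - W u w))) =
    (\int[P]_w (f w * g w)) * overlap s t u v.
Proof.
wlog su : s t u v f g / s <= u => [wl st uv bf bg|].
  have [su|/ltW us] := leP s u; first exact: wl.
  rewrite overlapC; have := wl u v s t g f us uv st bg bf.
  under eq_Rintegral do rewrite (mulrC (g _)) (mulrC (W v _ - _)).
  by move=> ->; under eq_Rintegral do rewrite mulrC.
move=> /andP[s0 st] /andP[u0 uv] bf bg.
have bfg : bounded_past u (fun w => f w * g w).
  by apply: bounded_pastM => //; exact: bounded_past_mono bf.
have [tu|/ltW ut] := leP t u.
  by rewrite overlap_disjoint// mulr0; exact: expectation_disjoint_increments.
rewrite overlapE//.
have i1 : P.-integrable setT (EFin \o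
    (fun w => f w * g w * ((W u w - W s w) * (W v w - W u w)))).
  by apply: bounded_increments_integrable bfg _ _; rewrite ?s0 ?u0.
have i2 : P.-integrable setT (EFin \o
    (fun w => f w * g w * ((W t w - W u w) * (W v w - W u w)))).
  by apply: bounded_increments_integrable bfg _ _; rewrite ?u0.
transitivity (\int[P]_w (f w * g w * ((W u w - W s w) * (W v w - W u w))) +
  \int[P]_w (f w * g w * ((W t w - W u w) * (W v w - W u w)))).
  by rewrite -RintegralD//; apply: eq_Rintegral => w _; ring.
rewrite expectation_disjoint_increments// add0r.
have [tv|/ltW vt] := leP t v; first exact: expectation_same_start.
under eq_Rintegral do rewrite (mulrC (W t _ - _)).
exact: expectation_same_start.
Qed.

Section simple_processes.
Variables (a b : R).
Hypothesis a0 : 0 <= a.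
Implicit Types h g : simple_process W a b.

Lemma sp_time_le h (k : 'I_(sp_size h)) :
  0 <= sp_time h k <= sp_time h k.+1.
Proof.
rewrite sp_time_mono// andbT (le_trans a0)//.
by have /andP[] := sp_time_itv (s := h) (ltnW (ltn_ord k)).
Qed.

Lemma sp_val_bounded_past h (k : 'I_(sp_size h)) :
  bounded_past (sp_time h k) (sp_val h k).
Proof.
split; first exact: sp_val_adapted.
by have [M hM] := sp_val_bounded h; exists M => w; exact: hM.
Qed.

Lemma sp_integral_Lfun2 h : sp_integral h \in L2.
Proof.
apply: Lfun2_sum => k _.
by apply: bounded_past_Lfun2M (sp_val_bounded_past k) _;
  exact/increment_Lfun2/sp_time_le.
Qed.

Lemma sp_process_Lfun2 h :
  (fun p => sp_process h p.2 p.1) \in Lfun (P \x mu)%E 2%:E.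
Proof.
apply: Lfun2_sum => k _.
have [pk [M kM]] := sp_val_bounded_past k.
apply: (@Lfun2_bounded_mul _ _ _ _ M) => [|p|].
- by apply: measurableT_comp => //; exact: past_measurable pk.
- exact: kM.
have [iT _] := tensor_integral (finite_measure_integrable_cst P 1 measurableT)
  (indic_itv_integrable (sp_time h k) (sp_time h k.+1)).
apply: (Lfun2_dominated _ iT).
- exact: measurableT_comp.
- by move=> p; rewrite mul1r indicE; case: (_ \in _); rewrite ?expr1n ?expr0n.
Qed.

(** Both sides are bilinear, and for a single step of each process they agree
    because the overlap of two intervals is the integral of the product of their
    indicators. *)
Lemma simple_isometry h g :
  \int[P]_w (sp_integral h w * sp_integral g w) =
  \int[(P \x mu)%E]_p (sp_process h p.2 p.1 * sp_process g p.2 p.1).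
Proof.
pose A k l w := sp_val h k w * sp_val g l w.
have iA (k : 'I_(sp_size h)) (l : 'I_(sp_size g)) : P.-integrable setT (EFin \o A k l).
  apply: (bounded_past_integrable (s := Num.max (sp_time h k) (sp_time g l))).
  by apply: bounded_pastM; apply: bounded_past_mono (sp_val_bounded_past _);
    rewrite le_max lexx ?orbT.
have iO (k : 'I_(sp_size h)) (l : 'I_(sp_size g)) : mu.-integrable setT (EFin \o (fun r =>
    (\1_`](sp_time h k), (sp_time h k.+1)] r : R) *
     \1_`](sp_time g l), (sp_time g l.+1)] r)).
  apply: (le_integrable measurableT _ _
    (indic_itv_integrable (sp_time h k) (sp_time h k.+1))).
    by apply/measurable_EFinP; exact: measurable_funM.
  move=> r _; rewrite /= lee_fin !indicE.
  by do 2 case: (_ \in _); rewrite ?mulr0 ?mul0r ?mulr1 ?normr0 ?normr1.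
transitivity (\sum_(k < sp_size h) \sum_(l < sp_size g) (\int[P]_w A k l w) *
    overlap (sp_time h k) (sp_time h k.+1) (sp_time g l) (sp_time g l.+1)).
  under eq_Rintegral do rewrite /sp_integral mulr_suml.
  under eq_Rintegral do under eq_bigr do rewrite mulr_sumr.
  pose F k l w := sp_val h k w * (W (sp_time h k.+1) w - W (sp_time h k) w) *
    (sp_val g l w * (W (sp_time g l.+1) w - W (sp_time g l) w)).
  have FE k l : F k l = fun w => A k l w *
    ((W (sp_time h k.+1) w - W (sp_time h k) w) *
     (W (sp_time g l.+1) w - W (sp_time g l) w)).
    by apply/funext => w; rewrite /F /A; ring.
  have iF (k : 'I_(sp_size h)) (l : 'I_(sp_size g)) :
      P.-integrable setT (EFin \o F k l).
    by apply: Lfun2_mul_integrable;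
      apply: bounded_past_Lfun2M (sp_val_bounded_past _) _;
      exact/increment_Lfun2/sp_time_le.
  have iFs k := (Rintegral_sum (index_enum _) (iF k)).1.
  rewrite (Rintegral_sum _ iFs).2.
  apply: eq_bigr => k _.
  rewrite (Rintegral_sum _ (iF k)).2; apply: eq_bigr => l _.
  rewrite FE; apply: expectation_increments; [exact: sp_time_le..| |];
    exact: sp_val_bounded_past.
under [RHS]eq_Rintegral do rewrite /sp_process mulr_suml.
under [RHS]eq_Rintegral do under eq_bigr do rewrite mulr_sumr.
pose G k l (p : Omega * R) := sp_val h k p.1 *
    (\1_`](sp_time h k), (sp_time h k.+1)] p.2 : R) *
  (sp_val g l p.1 * \1_`](sp_time g l), (sp_time g l.+1)] p.2).
have GE k l : G k l = fun p => A k l p.1 *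
  ((\1_`](sp_time h k), (sp_time h k.+1)] p.2 : R) *
     \1_`](sp_time g l), (sp_time g l.+1)] p.2).
  by apply/funext => p; rewrite /G /A; ring.
have iG (k : 'I_(sp_size h)) (l : 'I_(sp_size g)) :=
  tensor_integral (iA k l) (iO k l).
have iG1 (k : 'I_(sp_size h)) (l : 'I_(sp_size g)) :
    (P \x mu)%E.-integrable setT (EFin \o G k l).
  by rewrite GE; exact: (iG k l).1.
have iGs k := (Rintegral_sum (index_enum _) (iG1 k)).1.
rewrite (Rintegral_sum _ iGs).2.
apply: eq_bigr => k _.
rewrite (Rintegral_sum _ (iG1 k)).2; apply: eq_bigr => l _.
by rewrite GE (iG k l).2.
Qed.

Lemma expectation_past_simple h xi : past a xi -> xi \in L2 ->
  \int[P]_w (xi w * sp_integral h w) = 0.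
Proof.
move=> pxi xiL; under eq_Rintegral do rewrite /sp_integral mulr_sumr.
have iF (k : 'I_(sp_size h)) : P.-integrable setT (EFin \o (fun w => xi w *
    (sp_val h k w * (W (sp_time h k.+1) w - W (sp_time h k) w)))).
  apply: Lfun2_mul_integrable => //.
  by apply: bounded_past_Lfun2M (sp_val_bounded_past _) _;
    exact/increment_Lfun2/sp_time_le.
rewrite (Rintegral_sum _ iF).2 big1// => k _.
have [pk [M kM]] := sp_val_bounded_past k.
have ak : a <= sp_time h k.
  by have /andP[] := sp_time_itv (s := h) (ltnW (ltn_ord k)).
under eq_Rintegral do rewrite mulrA.
apply: (expectation_past_increment P_complete W_brownian (sp_time_le k)
  (f := fun w => xi w * sp_val h k w) _ _).2.
  by apply: measurable_funM => //; exact: past_mono pxi.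
apply: Lfun2_mul_integrable => //.
rewrite (_ : sp_val h k = fun w => sp_val h k w * 1); last first.
  by apply/funext => w; rewrite mulr1.
apply: bounded_past_Lfun2M (sp_val_bounded_past k) _.
exact: Lfun_cst.
Qed.

Lemma sp_process_outside h s w : ~ (a <= s <= b) -> sp_process h s w = 0.
Proof.
move=> nsab; rewrite /sp_process big1// => k _.
rewrite indicE memNset ?mulr0//= in_itv/= => /andP[ts st]; apply: nsab.
have /andP[at1 _] := sp_time_itv (s := h) (ltnW (ltn_ord k)).
have /andP[_ tb] := sp_time_itv (s := h) (ltn_ord k).
by rewrite (le_trans at1 (ltW ts)) (le_trans st tb).
Qed.

End simple_processes.

Section ito.
Variables (a b : R).
Hypothesis a0 : 0 <= a.
Implicit Types (H G K L : R -> Omega -> R) (I J : Omega -> R).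

Definition strip H (p : Omega * R) : R := \1_(`[a, b] : set R) p.2 * H p.2 p.1.

(** [version H K] allows an integrand to be replaced by a jointly measurable one
    that agrees with it on [a, b] off a single null set. *)
Definition version H K := [/\
  measurable_fun setT (fun p : Omega * R => K p.2 p.1) &
  {ae P, forall w s, a <= s <= b -> H s w = K s w}].

Lemma strip_measurable K : measurable_fun setT (fun p : Omega * R => K p.2 p.1) ->
  measurable_fun setT (strip K).
Proof. by move=> mK; apply: measurable_funM => //; exact: measurableT_comp. Qed.

(** Completeness of [P] is what makes the partial integrals of the integrand [H']
    in the definition measurable: they are known to equal those of [K] off a null
    set only. *)
Lemma ito_approximation H K I : version H K -> is_ito_integral W a b H I ->
  exists h : nat -> simple_process W a b, [/\ measurable_fun setT I,
    L2_cvg (P \x mu)%E (fun k p => sp_process (h k) p.2 p.1) (strip K) &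
    L2_cvg P (fun k => sp_integral (h k)) I].
Proof.
move=> [mK HK] [H' [h [_ HH' cH mI cI]]]; exists h; split => //.
rewrite /L2_cvg; apply: cvg_trans cH; apply: near_eq_cvg; apply: nearW => k.
have mF : measurable_fun setT (fun p : Omega * R =>
    ((strip K p - sp_process (h k) p.2 p.1) ^+ 2)%:E).
  apply/measurable_EFinP; apply: measurable_funX; apply: measurable_funB.
    exact: strip_measurable.
  by have /Lfun2_measurable := sp_process_Lfun2 (h k); exact.
have F0 (p : Omega * R) :
    (0 <= ((strip K p - sp_process (h k) p.2 p.1) ^+ 2)%:E)%E.
  by rewrite lee_fin sqr_ge0.
rewrite (@fubini_tonelli1 _ _ _ _ _ P mu _ mF F0) /fubini_F/=.
have e : {ae P, forall w,
  (\int[mu]_y ((strip K (w, y) - sp_process (h k) y w) ^+ 2)%:E)%E =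
  (\int[mu]_(s in `[a, b]) ((H' s w - sp_process (h k) s w) ^+ 2)%:E)%E}.
  apply: filterS2 HK HH' => w HKw HH'w.
  rewrite [RHS]integral_mkcond; apply: eq_integral => s _.
  rewrite patchE /strip/= indicE mem_setE in_itv/=.
  case: ifPn => [sab|/negP sab]; first by rewrite mul1r -HKw// HH'w.
  by rewrite sp_process_outside// mul0r subr0 expr0n.
apply/esym; apply: ae_eq_integral => //.
- exact: (measurable_fun_fubini_tonelli_F (m2 := mu) _ mF F0).
- apply: (ae_measurable_fun P_complete _
    (measurable_fun_fubini_tonelli_F (m2 := mu) _ mF F0)).
  by apply: filterS e => w + _; exact.
- by apply: filterS e => w + _; exact.
Qed.

Lemma ito_Lfun2 H K I : version H K -> is_ito_integral W a b H I ->
  I \in L2 /\ strip K \in Lfun (P \x mu)%E 2%:E.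
Proof.
move=> HK /(ito_approximation HK)[h [mI cK cI]]; split.
  by apply: L2_cvg_Lfun2 mI cI => k; exact: sp_integral_Lfun2.
apply: L2_cvg_Lfun2 cK; last by apply: strip_measurable; case: HK.
by move=> k; exact: sp_process_Lfun2.
Qed.

Lemma ito_isometry H K I G L J :
  version H K -> is_ito_integral W a b H I ->
  version G L -> is_ito_integral W a b G J ->
  \int[P]_w (I w * J w) = \int[(P \x mu)%E]_p (strip K p * strip L p).
Proof.
move=> HK /(ito_approximation HK)[h [mI cK cI]].
move=> GL /(ito_approximation GL)[g [mJ cL cJ]].
have mK := strip_measurable HK.1; have mL := strip_measurable GL.1.
have := L2_cvg_inner (fun k => sp_integral_Lfun2 a0 (h k))
  (fun k => sp_integral_Lfun2 a0 (g k)) mI mJ cI cJ.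
have := L2_cvg_inner (fun k => sp_process_Lfun2 (h k))
  (fun k => sp_process_Lfun2 (g k)) mK mL cK cL.
under [X in X @ _ --> _]eq_fun do rewrite -(simple_isometry a0).
by move=> c1 c2; apply: cvg_unique c2 c1; exact: Rhausdorff.
Qed.

Lemma ito_past_orthogonal H K I xi : version H K -> is_ito_integral W a b H I ->
  past a xi -> xi \in L2 -> \int[P]_w (xi w * I w) = 0.
Proof.
move=> HK /(ito_approximation HK)[h [mI cK cI]] pxi xiL.
have cxi : L2_cvg P (fun=> xi) xi.
  rewrite /L2_cvg; under eq_fun do under eq_integral do rewrite subrr expr0n/=.
  by under eq_fun do rewrite integral0; exact: cvg_cst.
have := L2_cvg_inner (fun=> xiL) (fun k => sp_integral_Lfun2 a0 (h k))
  (past_measurable pxi) mI cxi cI.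
under [X in X @ _ --> _]eq_fun do rewrite (expectation_past_simple a0 _ pxi xiL).
by move=> c; apply: cvg_unique c (cvg_cst _); exact: Rhausdorff.
Qed.

End ito.

End simple_isometry.

(** * Iterated products of sigma-finite measures *)

Section sigma_finite_product.
Context {R : realType} d1 d2 (T1 : measurableType d1) (T2 : measurableType d2).
Variables (m1 : {sigma_finite_measure set T1 -> \bar R})
          (m2 : {sigma_finite_measure set T2 -> \bar R}).

(** The product measure under a name of its own, for its sigma-finiteness to be
    inferred when it is in turn a factor of a product. *)
Definition sfprod : set (T1 * T2) -> \bar R := (m1 \x m2)%E.

HB.instance Definition _ := Measure.on sfprod.

Let sfprod_sigma_finite : sigma_finite setT sfprod.
Proof.
have /sigma_finiteP[A [AT ndA Afin]] := sigma_finiteT m1.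
have /sigma_finiteP[B [BT ndB Bfin]] := sigma_finiteT m2.
exists (fun k => A k `*` B k) => [|k].
  apply/esym; rewrite -subTset => -[x y] _.
  have [i _ Aix] : (\bigcup_k A k) x by rewrite -AT.
  have [j _ Bjy] : (\bigcup_k B k) y by rewrite -BT.
  exists (maxn i j) => //; split => /=.
    by have /subsetPset := ndA _ _ (leq_maxl i j); exact.
  by have /subsetPset := ndB _ _ (leq_maxr i j); exact.
have [mA Aoo] := Afin k; have [mB Boo] := Bfin k.
split; first exact: measurableX.
rewrite [sfprod _]product_measure1E//.
by rewrite lte_mul_pinfty// ge0_fin_numE.
Qed.

HB.instance Definition _ :=
  Measure_isSigmaFinite.Build _ _ _ sfprod sfprod_sigma_finite.

End sigma_finite_product.
Arguments sfprod {R d1 d2 T1 T2}.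

Notation "m1 \X m2" := (sfprod m1 m2) (at level 40, left associativity).

Section integral_complements.
Context d (T : measurableType d) (R : realType).
Variable m : {measure set T -> \bar R}.

Lemma Lfun2_dominated_ae (f g : T -> R) : measurable_fun setT f ->
  m.-integrable setT (EFin \o g) -> {ae m, forall x, f x ^+ 2 <= g x} ->
  f \in Lfun m 2%:E.
Proof.
move=> mf ig fg; apply/Lfun2P; split => //.
have /integrableP[mg] := ig; apply: le_lt_trans.
apply: ae_ge0_le_integral => //.
- by move=> x _; rewrite lee_fin sqr_ge0.
- by apply/measurable_EFinP; exact: measurable_funX.
- exact: measurableT_comp.
- by apply: filterS fg => x fgx _; rewrite /= lee_fin (le_trans fgx)// ler_norm.
Qed.

Lemma Rintegral_ae_eq_complete (f g : T -> R) : measure_is_complete m ->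
  measurable_fun setT g -> {ae m, forall x, f x = g x} ->
  \int[m]_x f x = \int[m]_x g x.
Proof.
move=> cm mg fg; apply: Rintegral_ae_eq => //; apply/measurable_EFinP.
apply: (ae_measurable_fun cm (f := EFin \o g)); last exact/measurable_EFinP.
by apply: filterS fg => x /= ->.
Qed.

(** A change of variables that is known for nonnegative functions extends to
    integrable ones through their positive and negative parts. *)
Lemma measure_preserving_integral d' (T' : measurableType d')
    (m' : {measure set T' -> \bar R}) (th : T' -> T) :
  measurable_fun setT th ->
  (forall f : T -> \bar R, measurable_fun setT f -> (forall x, 0 <= f x)%E ->
    (\int[m']_x f (th x) = \int[m]_x f x)%E) ->
  forall f : T -> R, m.-integrable setT (EFin \o f) ->
  m'.-integrable setT (EFin \o (f \o th)) /\
  \int[m']_x f (th x) = \int[m]_x f x.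
Proof.
move=> mth th_int f /integrableP[mf f_int]; split.
  apply/integrableP; split; first exact: (measurableT_comp mf).
  by rewrite (th_int (fun x => `|(EFin \o f) x|)%E)//; exact: measurableT_comp.
congr fine; rewrite integralE [RHS]integralE.
rewrite -(th_int (EFin \o f)^\+%E)//; last exact: measurable_funepos.
rewrite -(th_int (EFin \o f)^\-%E)//; last exact: measurable_funeneg.
by congr (_ - _)%E; apply: eq_integral => x _; rewrite ?funeposE ?funenegE.
Qed.

End integral_complements.

Section product_complements.
Context {R : realType} d1 d2 (T1 : measurableType d1) (T2 : measurableType d2).
Variables (m1 : {sigma_finite_measure set T1 -> \bar R})
          (m2 : {sigma_finite_measure set T2 -> \bar R}).

Lemma ae_fst (Q : T1 -> Prop) : {ae m1, forall x, Q x} ->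
  {ae (m1 \X m2), forall p, Q p.1}.
Proof.
move=> [N [mN N0 QN]]; exists (N `*` setT); split.
- exact: measurableX.
- transitivity (m1 N * m2 setT)%E; first exact: product_measure1E.
  by rewrite N0 mul0e.
- by move=> [x y]/= nQ; split => //; exact: QN.
Qed.

Lemma swap_integral (f : T2 * T1 -> R) :
  (m2 \X m1).-integrable setT (EFin \o f) ->
  (m1 \X m2).-integrable setT (EFin \o (f \o (fun p => (p.2, p.1)))) /\
  \int[(m1 \X m2)]_p f (p.2, p.1) = \int[(m2 \X m1)]_p f p.
Proof.
have mswap : measurable_fun setT (fun p : T1 * T2 => (p.2, p.1)).
  exact: measurable_fun_pair.
apply: measure_preserving_integral => // g mg g0.
rewrite (fubini_tonelli1 (m2 := m2) (fun p => g (p.2, p.1)))//; last first.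
  exact: measurableT_comp.
by rewrite (fubini_tonelli2 g).
Qed.

Lemma Lfun2_section (f : T1 * T2 -> R) : f \in Lfun (m1 \X m2) 2%:E ->
  {ae m1, forall x, (fun y => f (x, y)) \in Lfun m2 2%:E}.
Proof.
move=> fL; have := ae_integrable1 (Lfun2_integrable_sqr fL).
apply: filterS => x ix; apply/Lfun2P; split; last exact: integrable_lty ix.
apply: measurableT_comp; first exact: Lfun2_measurable fL.
exact: measurable_fun_pair.
Qed.

Lemma Rintegral_fubini_weight (v : T1 -> R) (b : T1 * T2 -> R) :
  measurable_fun setT v -> (m1 \X m2).-integrable setT (EFin \o b) ->
  (m1 \X m2).-integrable setT (EFin \o (fun p => v p.1 * b p)) ->
  \int[(m1 \X m2)]_p (v p.1 * b p) = \int[m1]_x (v x * \int[m2]_y b (x, y)).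
Proof.
move=> mv ib ivb; rewrite Rintegral_fubini//.
have mb : measurable_fun setT b by apply/measurable_EFinP; exact: measurable_int ib.
apply: Rintegral_ae_eq.
- apply: (@measurable_Rintegral_snd _ _ _ _ _ m2 (fun p => v p.1 * b p)).
  apply: measurable_funM => //.
  exact: measurableT_comp.
- by apply: measurable_funM => //; exact: measurable_Rintegral_snd.
apply: filterS (ae_integrable1 ib) => x ibx.
exact: (RintegralZl (f := fun y => b (x, y)) (v x) measurableT ibx).
Qed.

End product_complements.

Section space_time.
Context {R : realType} {dT d : measure_display}.
Context {T : measurableType dT} {Omega : measurableType d}.
Variables (mu : {sigma_finite_measure set T -> \bar R})
          (P : {sigma_finite_measure set Omega -> \bar R}).
Local Notation Q := ((mu \X mu) \X P).

Lemma tonelli3 (f : T * T * Omega -> \bar R) :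
  measurable_fun setT f -> (forall q, 0 <= f q)%E ->
  (\int[Q]_q f q = \int[mu]_t \int[mu]_s \int[P]_w f (t, s, w))%E /\
  (\int[Q]_q f q = \int[mu]_s \int[mu]_t \int[P]_w f (t, s, w))%E.
Proof.
move=> mf f0.
have mF := measurable_fun_fubini_tonelli_F (m2 := P) f mf f0.
have F0 p : (0 <= fubini_F P f p)%E by exact: integral_ge0.
have -> : (\int[Q]_q f q = \int[mu \X mu]_p fubini_F P f p)%E.
  exact: (fubini_tonelli1 (m1 := mu \X mu) f mf f0).
split; first exact: (fubini_tonelli1 _ mF F0).
exact: (fubini_tonelli2 _ mF F0).
Qed.

Lemma swap_times_integral (f : T * T * Omega -> R) :
  Q.-integrable setT (EFin \o f) ->
  Q.-integrable setT (EFin \o (f \o (fun q => (q.1.2, q.1.1, q.2)))) /\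
  \int[Q]_q f (q.1.2, q.1.1, q.2) = \int[Q]_q f q.
Proof.
have mth : measurable_fun setT (fun q : T * T * Omega => (q.1.2, q.1.1, q.2)).
  apply: measurable_fun_pair => //; apply: measurable_fun_pair;
  exact: measurableT_comp.
apply: measure_preserving_integral => // g mg g0.
have [-> _] := tonelli3 (measurableT_comp mg mth) (fun q => g0 _).
by have [_ ->] := tonelli3 mg g0.
Qed.

Lemma time_slice_integral (f : T * T * Omega -> R) :
  Q.-integrable setT (EFin \o f) ->
  (mu \X (P \X mu)).-integrable setT
    (EFin \o (f \o (fun r => (r.1, r.2.2, r.2.1)))) /\
  \int[(mu \X (P \X mu))]_r f (r.1, r.2.2, r.2.1) = \int[Q]_q f q.
Proof.
have mth : measurable_fun setT
    (fun r : T * (Omega * T) => (r.1, r.2.2, r.2.1)).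
  apply: measurable_fun_pair; last exact: measurableT_comp.
  by apply: measurable_fun_pair => //; exact: measurableT_comp.
apply: measure_preserving_integral => // g mg g0.
have [-> _] := tonelli3 mg g0.
have mg' := measurableT_comp mg mth.
transitivity (\int[mu]_t \int[(P \X mu)]_p g (t, p.2, p.1))%E.
  exact: (fubini_tonelli1 (m2 := P \X mu) _ mg' (fun=> g0 _)).
apply: eq_integral => t _.
have mgt : measurable_fun setT (fun p : Omega * T => g (t, p.2, p.1)).
  apply: measurableT_comp => //; apply: measurable_fun_pair => //.
  exact: measurable_fun_pair.
exact: (fubini_tonelli2 _ mgt (fun=> g0 _)).
Qed.

End space_time.

(** * Mean-field operators and their adjoints *)

Section mean_field_operator_at.
Context {R : realType} d (Omega : measurableType d).
Variable P : probability Omega R.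
Local Notation L2 := (Lfun P 2%:E).

Lemma Lfun2_norm (f : Omega -> R) : f \in L2 -> (fun w => `|f w|) \in L2.
Proof.
move=> fL; apply: (Lfun2_dominated (g := fun w => f w ^+ 2)).
- by apply: measurableT_comp => //; exact: Lfun2_measurable fL.
- exact: Lfun2_integrable_sqr.
- by move=> w; rewrite real_normK ?num_real.
Qed.

Lemma Lfun2_one : (fun=> 1) \in L2.
Proof. exact: Lfun_cst. Qed.

Lemma Lfun2_integrable (f : Omega -> R) : f \in L2 ->
  P.-integrable setT (EFin \o f).
Proof.
move=> fL; have := Lfun2_mul_integrable Lfun2_one fL.
by apply: eq_integrable => // w _; rewrite /= mul1r.
Qed.

Lemma sum_bounded_Lfun2 (J : finType) (b v : J -> Omega -> R) (K : R) :
  (forall j, measurable_fun setT (b j)) -> (forall j w, `|b j w| <= K) ->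
  (forall j, v j \in L2) -> (fun w => \sum_j b j w * v j w) \in L2.
Proof.
move=> mb bK vL; apply: Lfun2_sum => j _.
by apply: (@Lfun2_bounded_mul _ _ _ _ K).
Qed.

(** Jensen's inequality for the square, followed by the bound on the
    coefficients. *)
Lemma mean_sqr_le (J : finType) (b v : J -> Omega -> R) (K : R) :
  0 <= K ->
  (forall j, measurable_fun setT (b j)) -> (forall j w, `|b j w| <= K) ->
  (forall j, v j \in L2) ->
  (\int[P]_w \sum_j b j w * v j w) ^+ 2 <=
    K ^+ 2 * \int[P]_w (\sum_j `|v j w|) ^+ 2.
Proof.
move=> K0 mb bK vL.
pose h w := \sum_j b j w * v j w.
have hL : h \in L2 by exact: sum_bounded_Lfun2 bK vL.
have rL : (fun w => \sum_j `|v j w|) \in L2.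
  by apply: Lfun2_sum => j _; exact: Lfun2_norm.
have h2_ge0 : 0 <= \int[P]_w h w ^+ 2.
  by apply: Rintegral_ge0 => w _; exact: sqr_ge0.
have -> : \int[P]_w \sum_j b j w * v j w = \int[P]_w (1 * h w).
  by apply: eq_Rintegral => w _; rewrite mul1r.
apply: (@le_trans _ _ (\int[P]_w h w ^+ 2)).
  have := cauchy_schwarz Lfun2_one hL.
  rewrite (_ : \int[P]_w 1 ^+ 2 = 1); last first.
    under eq_Rintegral do rewrite expr1n.
    have P1 : fine (P setT) = 1 by rewrite probability_setT.
    by rewrite Rintegral_cst// mul1r.
  rewrite sqrtr1 mul1r => le_sqrt.
  rewrite -[leLHS]real_normK ?num_real// -[leRHS]sqr_sqrtr//.
  by rewrite ler_sqr ?nnegrE ?sqrtr_ge0.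
rewrite -RintegralZl//; last exact: Lfun2_integrable_sqr.
apply: le_Rintegral => //.
- exact: Lfun2_integrable_sqr.
- have := integrableZl measurableT (K ^+ 2) (Lfun2_integrable_sqr rL).
  by apply: eq_integrable => // w _; rewrite /= EFinM.
move=> w _; rewrite -exprMn -[leLHS]real_normK ?num_real//.
rewrite ler_sqr ?nnegrE ?mulr_ge0// ?sumr_ge0//.
apply: (le_trans (ler_norm_sum _ _ _)); rewrite mulr_sumr.
by apply: ler_sum => j _; rewrite normrM ler_wpM2r.
Qed.

(** The mean-field operator acting on random vectors: [a] multiplies pointwise,
    while [c] acts as the kernel of an integral operator on [Omega]. *)
Definition mf_at (I J : finType) (a : I -> J -> Omega -> R)
    (c : I -> J -> Omega * Omega -> R) (v : J -> Omega -> R) (i : I) (w : Omega) :=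
  \sum_j a i j w * v j w + \int[P]_w' \sum_j c i j (w, w') * v j w'.

Section adjoint.
Variable K : R.
Hypothesis K0 : 0 <= K.

Let pairing_integrable (I J : finType) (c : I -> J -> Omega * Omega -> R)
    (u : I -> Omega -> R) (v : J -> Omega -> R) :
  (forall i j, measurable_fun setT (c i j)) -> (forall i j p, `|c i j p| <= K) ->
  (forall i, u i \in L2) -> (forall j, v j \in L2) ->
  (P \x P)%E.-integrable setT
    (EFin \o (fun p => \sum_i \sum_j u i p.1 * (c i j p * v j p.2))).
Proof.
move=> mc cK uL vL.
apply: (Rintegral_sum _ (fun i => _)).1 => i.
apply: (Rintegral_sum _ (fun j => _)).1 => j.
have [iuv _] := tensor_integral (Lfun2_integrable (uL i)) (Lfun2_integrable (vL j)).
apply: (le_integrable measurableT _ _ (integrableZl measurableT K iuv)).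
  apply/measurable_EFinP; apply: measurable_funM.
    by apply: measurableT_comp => //; exact: Lfun2_measurable (uL i).
  apply: measurable_funM => //.
  by apply: measurableT_comp => //; exact: Lfun2_measurable (vL j).
move=> p _; rewrite /= lee_fin mulrCA normrM (normrM K) (ger0_norm K0).
by rewrite ler_wpM2r.
Qed.

Let pairingE (I J : finType) (a : I -> J -> Omega -> R)
    (c : I -> J -> Omega * Omega -> R) (u : I -> Omega -> R) (v : J -> Omega -> R) :
  (forall i j, measurable_fun setT (a i j)) -> (forall i j w, `|a i j w| <= K) ->
  (forall i j, measurable_fun setT (c i j)) -> (forall i j p, `|c i j p| <= K) ->
  (forall i, u i \in L2) -> (forall j, v j \in L2) ->
  \int[P]_w (\sum_i u i w * mf_at a c v i w) =
  \int[P]_w (\sum_i \sum_j u i w * (a i j w * v j w)) +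
  \int[(P \x P)%E]_p (\sum_i \sum_j u i p.1 * (c i j p * v j p.2)).
Proof.
move=> ma aK mc cK uL vL.
have iF := pairing_integrable mc cK uL vL.
rewrite (Rintegral_fubini iF) -RintegralD//; last 2 first.
- have [+ _] := Rintegral_sum (index_enum I) (fun i =>
    Lfun2_mul_integrable (uL i) (sum_bounded_Lfun2 (ma i) (aK i) vL)).
  apply: eq_integrable => // w _; congr EFin; apply: eq_bigr => i _.
  by rewrite mulr_sumr.
- exact: Rintegral_fubini_integrable iF.
apply: eq_Rintegral => w _; rewrite /mf_at.
under eq_bigr do rewrite mulrDr mulr_sumr.
rewrite big_split/=; congr (_ + _).
have ih i : P.-integrable setT (EFin \o (fun w' => \sum_j c i j (w, w') * v j w')).
  apply: Lfun2_integrable; apply: sum_bounded_Lfun2 (fun j w' => cK i j _) vL => j.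
  by apply: measurableT_comp => //; exact: measurable_fun_pair.
have iuh i : P.-integrable setT
    (EFin \o (fun w' => u i w * \sum_j c i j (w, w') * v j w')).
  have := integrableZl measurableT (u i w) (ih i).
  by apply: eq_integrable => // w' _; rewrite /= EFinM.
have [_ sumE] := Rintegral_sum (index_enum I) iuh.
transitivity (\int[P]_w' \sum_i u i w * \sum_j c i j (w, w') * v j w').
  by rewrite sumE; apply: eq_bigr => i _; rewrite RintegralZl.
apply: eq_Rintegral => w' _; apply: eq_bigr => i _.
by rewrite mulr_sumr.
Qed.

(** Both sides integrate the same function of [(w, w')] over the product space:
    transposing the coefficients exchanges the two copies of [Omega]. *)
Lemma mf_at_adjoint (I J : finType) (a : I -> J -> Omega -> R)
    (c : I -> J -> Omega * Omega -> R) (u : I -> Omega -> R) (v : J -> Omega -> R) :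
  (forall i j, measurable_fun setT (a i j)) -> (forall i j w, `|a i j w| <= K) ->
  (forall i j, measurable_fun setT (c i j)) -> (forall i j p, `|c i j p| <= K) ->
  (forall i, u i \in L2) -> (forall j, v j \in L2) ->
  \int[P]_w (\sum_i u i w * mf_at a c v i w) =
  \int[P]_w (\sum_j v j w *
    mf_at (fun j i => a i j) (fun j i p => c i j (p.2, p.1)) u j w).
Proof.
move=> ma aK mc cK uL vL.
have mc' j i : measurable_fun setT (fun p : Omega * Omega => c i j (p.2, p.1)).
  by apply: measurableT_comp => //; exact: measurable_fun_pair.
rewrite (pairingE ma aK mc cK uL vL).
rewrite (@pairingE J I (fun j i => a i j) (fun j i p => c i j (p.2, p.1)) v u
  (fun j i => ma i j) (fun j i => aK i j) mc' (fun j i p => cK i j _) vL uL).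
congr (_ + _).
  apply: eq_Rintegral => w _; rewrite exchange_big/=.
  by apply: eq_bigr => j _; apply: eq_bigr => i _; ring.
have [_ <-] := swap_integral (m1 := P) (m2 := P) (pairing_integrable mc cK uL vL).
apply: eq_Rintegral => p _; rewrite exchange_big/=.
by apply: eq_bigr => j _; apply: eq_bigr => i _; ring.
Qed.

End adjoint.

End mean_field_operator_at.

Section mean_field_operator.
Context {R : realType} {dT d : measure_display}.
Context {T : measurableType dT} {Omega : measurableType d}.
Variables (mu : {sigma_finite_measure set T -> \bar R}) (P : probability Omega R).
Local Notation Q := ((mu \X mu) \X P).
Variable K : R.
Hypothesis K0 : 0 <= K.

(** The action at [(t, s, w)] of the local and the mean-field coefficients on a
    kernel; the adjoint operator has the transposed coefficients, with the two
    copies of [Omega] exchanged. *)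
Definition mf_op (I J : finType) (a : I -> J -> T * T * Omega -> R)
    (c : I -> J -> T * T * (Omega * Omega) -> R) (v : J -> T * T * Omega -> R)
    (i : I) (q : T * T * Omega) : R :=
  mf_at P (fun i j w => a i j (q.1, w)) (fun i j p => c i j (q.1, p))
    (fun j w => v j (q.1, w)) i q.2.

Definition tr_local (I J : finType) (a : I -> J -> T * T * Omega -> R) :=
  fun j i => a i j.

Definition tr_mean (I J : finType) (c : I -> J -> T * T * (Omega * Omega) -> R) :=
  fun j i (q : T * T * (Omega * Omega)) => c i j (q.1, (q.2.2, q.2.1)).

Section one_operator.
Variables (I J : finType) (a : I -> J -> T * T * Omega -> R)
  (c : I -> J -> T * T * (Omega * Omega) -> R).
Hypothesis ma : forall i j, measurable_fun setT (a i j).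
Hypothesis aK : forall i j q, `|a i j q| <= K.
Hypothesis mc : forall i j, measurable_fun setT (c i j).
Hypothesis cK : forall i j q, `|c i j q| <= K.

Lemma tr_mean_measurable j i : measurable_fun setT (tr_mean c j i).
Proof.
apply: measurableT_comp => //; apply: measurable_fun_pair => //.
by apply: measurable_fun_pair; exact: measurableT_comp.
Qed.

Lemma ae_slices_Lfun2 (v : J -> T * T * Omega -> R) :
  (forall j, v j \in Lfun Q 2%:E) ->
  {ae mu \X mu, forall p, forall j, (fun w => v j (p, w)) \in Lfun P 2%:E}.
Proof.
move=> vL; apply: filter_forall => j.
exact: (@Lfun2_section _ _ _ _ _ (mu \X mu) P).
Qed.

Let mean_measurable (v : J -> T * T * Omega -> R) i :
  (forall j, measurable_fun setT (v j)) ->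
  measurable_fun setT (fun q : T * T * Omega =>
    \int[P]_w' \sum_j c i j (q.1, (q.2, w')) * v j (q.1, w')).
Proof.
move=> mv; apply: (@measurable_Rintegral_snd _ _ _ _ _ P
  (fun r : T * T * Omega * Omega =>
     \sum_j c i j (r.1.1, (r.1.2, r.2)) * v j (r.1.1, r.2))).
apply: measurable_sum => j; apply: measurable_funM.
  apply: measurableT_comp => //; apply: measurable_fun_pair.
    exact: measurableT_comp.
  by apply: measurable_fun_pair => //; exact: measurableT_comp.
apply: measurableT_comp => //; apply: measurable_fun_pair => //.
exact: measurableT_comp.
Qed.

(** The square of the mean-field part is bounded by the mean square of the argument
    at the same pair of times, a bound that is constant in the outcome and
    integrable in the times. *)
Lemma mf_op_Lfun2 (v : J -> T * T * Omega -> R) i :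
  (forall j, v j \in Lfun Q 2%:E) -> mf_op a c v i \in Lfun Q 2%:E.
Proof.
move=> vL.
have mv j : measurable_fun setT (v j) by exact: Lfun2_measurable (vL j).
have locL : (fun q => \sum_j a i j q * v j q) \in Lfun Q 2%:E.
  by apply: Lfun2_sum => j _; apply: (@Lfun2_bounded_mul _ _ _ _ K).
pose r q := \sum_j `|v j q|.
have rL : r \in Lfun Q 2%:E.
  apply: Lfun2_sum => j _; apply: (Lfun2_dominated (g := fun q => v j q ^+ 2)).
  - by apply: measurableT_comp => //; exact: mv.
  - exact: Lfun2_integrable_sqr.
  - by move=> q; rewrite real_normK ?num_real.
have ir := Rintegral_fubini_integrable (m1 := mu \X mu) (m2 := P)
  (Lfun2_integrable_sqr rL).
have [ig _] := tensor_integral (m1 := mu \X mu) (m2 := P)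
  (integrableZl measurableT (K ^+ 2) ir)
  (finite_measure_integrable_cst P 1 measurableT).
have meanL : (fun q : T * T * Omega =>
    \int[P]_w' \sum_j c i j (q.1, (q.2, w')) * v j (q.1, w')) \in Lfun Q 2%:E.
  apply: (Lfun2_dominated_ae _ ig); first exact: mean_measurable.
  apply: filterS (ae_fst P (ae_slices_Lfun2 vL)) => q vqL /=.
  rewrite mulr1; apply: mean_sqr_le => // j.
  by apply: measurableT_comp => //; apply: measurable_fun_pair.
rewrite (_ : mf_op a c v i = fun q => \sum_j a i j q * v j q +
    \int[P]_w' \sum_j c i j (q.1, (q.2, w')) * v j (q.1, w')).
  exact: Lfun2D.
by apply/funext => -[p w].
Qed.

Lemma sum_mul_integrable (A : finType) (f g : A -> T * T * Omega -> R) :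
  (forall k, f k \in Lfun Q 2%:E) -> (forall k, g k \in Lfun Q 2%:E) ->
  Q.-integrable setT (EFin \o (fun q => \sum_k f k q * g k q)).
Proof.
move=> fL gL; apply: (Rintegral_sum _ (fun k => _)).1 => k.
exact: Lfun2_mul_integrable.
Qed.

End one_operator.

Lemma mf_op_adjoint (I J : finType) (a : I -> J -> T * T * Omega -> R)
    (c : I -> J -> T * T * (Omega * Omega) -> R)
    (u : I -> T * T * Omega -> R) (v : J -> T * T * Omega -> R) :
  (forall i j, measurable_fun setT (a i j)) -> (forall i j q, `|a i j q| <= K) ->
  (forall i j, measurable_fun setT (c i j)) -> (forall i j q, `|c i j q| <= K) ->
  (forall i, u i \in Lfun Q 2%:E) -> (forall j, v j \in Lfun Q 2%:E) ->
  \int[Q]_q (\sum_i u i q * mf_op a c v i q) =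
  \int[Q]_q (\sum_j v j q * mf_op (tr_local a) (tr_mean c) u j q).
Proof.
move=> ma aK mc cK uL vL.
pose F q := \sum_i u i q * mf_op a c v i q.
pose G q := \sum_j v j q * mf_op (tr_local a) (tr_mean c) u j q.
have iF : Q.-integrable setT (EFin \o F) :=
  sum_mul_integrable uL (fun i => mf_op_Lfun2 ma aK mc cK i vL).
have iG : Q.-integrable setT (EFin \o G) :=
  sum_mul_integrable vL (fun j => mf_op_Lfun2 (fun j i => ma i j)
    (fun j i => aK i j) (tr_mean_measurable mc) (fun j i q => cK i j _) j uL).
have mF := measurable_int _ iF; have mG := measurable_int _ iG.
rewrite [LHS](Rintegral_fubini (m1 := mu \X mu) (m2 := P) iF).
rewrite [RHS](Rintegral_fubini (m1 := mu \X mu) (m2 := P) iG).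
apply: Rintegral_ae_eq.
- by apply: (@measurable_Rintegral_snd _ _ _ _ _ P F); exact/measurable_EFinP.
- by apply: (@measurable_Rintegral_snd _ _ _ _ _ P G); exact/measurable_EFinP.
apply: filterS2 (ae_slices_Lfun2 uL) (ae_slices_Lfun2 vL) => p upL vpL.
have map i j : measurable_fun setT (fun w => a i j (p, w)).
  by apply: measurableT_comp => //; exact: measurable_fun_pair.
have mcp i j : measurable_fun setT (fun r => c i j (p, r)).
  by apply: measurableT_comp => //; exact: measurable_fun_pair.
exact: (mf_at_adjoint K0 map (fun i j w => aK i j _) mcp
  (fun i j r => cK i j _) upL vpL).
Qed.

Lemma swap_times_Lfun2 (f : T * T * Omega -> R) : f \in Lfun Q 2%:E ->
  (fun q => f (q.1.2, q.1.1, q.2)) \in Lfun Q 2%:E.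
Proof.
move=> fL; have [i2 _] := swap_times_integral (Lfun2_integrable_sqr fL).
apply/Lfun2P; split; last exact: integrable_lty i2.
apply: measurableT_comp; first exact: Lfun2_measurable fL.
apply: measurable_fun_pair => //.
by apply: measurable_fun_pair; exact: measurableT_comp.
Qed.

Lemma time_slice_Lfun2 (f : T * T * Omega -> R) : f \in Lfun Q 2%:E ->
  {ae mu, forall t, (fun p => f (t, p.2, p.1)) \in Lfun (P \X mu) 2%:E}.
Proof.
move=> fL; have [i2 _] := time_slice_integral (Lfun2_integrable_sqr fL).
have fL' : (fun r : T * (Omega * T) => f (r.1, r.2.2, r.2.1)) \in
    Lfun (mu \X (P \X mu)) 2%:E.
  apply/Lfun2P; split; last exact: integrable_lty i2.
  apply: measurableT_comp; first exact: Lfun2_measurable fL.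
  apply: measurable_fun_pair; last exact: measurableT_comp.
  by apply: measurable_fun_pair => //; exact: measurableT_comp.
exact: (Lfun2_section (m1 := mu) (m2 := P \X mu) fL').
Qed.

Lemma time_slices (f : T * T * Omega -> R) : Q.-integrable setT (EFin \o f) ->
  mu.-integrable setT (EFin \o (fun t => \int[P \X mu]_p f (t, p.2, p.1))) /\
  \int[Q]_q f q = \int[mu]_t \int[P \X mu]_p f (t, p.2, p.1).
Proof.
move=> i_f; have [i3 <-] := time_slice_integral i_f; split.
- exact: (Rintegral_fubini_integrable (m1 := mu) (m2 := P \X mu) i3).
- exact: (Rintegral_fubini (m1 := mu) (m2 := P \X mu) i3).
Qed.

(** A process seen as a kernel, constant in the other time variable over a set
    of finite measure. *)
Lemma process_kernel_Lfun2 (S : set T) (x : T * Omega -> R) : measurable S ->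
  (mu S < +oo)%E -> x \in Lfun (mu \X P) 2%:E ->
  (fun q : T * T * Omega => \1_S q.1.1 * x (q.1.2, q.2)) \in Lfun Q 2%:E.
Proof.
move=> mS muS /Lfun2P[mx x2].
have mx2 : measurable_fun setT (fun p => (x p ^+ 2)%:E).
  by apply/measurable_EFinP; exact: measurable_funX.
have mf : measurable_fun setT
    (fun q : T * T * Omega => \1_S q.1.1 * x (q.1.2, q.2)).
  apply: measurable_funM.
    by apply: measurableT_comp => //; exact: measurableT_comp.
  apply: measurableT_comp => //; apply: measurable_fun_pair => //.
  exact: measurableT_comp.
apply/Lfun2P; split => //.
pose f (q : T * T * Omega) := ((\1_S q.1.1 * x (q.1.2, q.2)) ^+ 2)%:E.
have mf2 : measurable_fun setT f.
  by apply/measurable_EFinP; exact: measurable_funX.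
have f0 q : (0 <= f q)%E by rewrite lee_fin sqr_ge0.
have inner t s : (\int[P]_w f (t, s, w) =
    (\1_S t)%:E * \int[P]_w (x (s, w) ^+ 2)%:E)%E.
  rewrite -ge0_integralZl//; last 2 first.
  - by apply: measurableT_comp mx2 _; exact: measurable_fun_pair.
  - by move=> w _; rewrite lee_fin sqr_ge0.
  apply: eq_integral => w _; rewrite /f/= -EFinM exprMn; congr (_ * _)%:E.
  by rewrite indicE; case: (_ \in _); rewrite ?expr1n ?expr0n.
have x20 p : (0 <= (x p ^+ 2)%:E)%E by rewrite lee_fin sqr_ge0.
have outer t : (\int[mu]_s \int[P]_w f (t, s, w) =
    (\1_S t)%:E * \int[mu \X P]_p (x p ^+ 2)%:E)%E.
  under eq_integral do rewrite inner.
  rewrite ge0_integralZl//; last 2 first.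
  - exact: (measurable_fun_fubini_tonelli_F _ mx2 x20).
  - by move=> s _; apply: integral_ge0 => w _; rewrite lee_fin sqr_ge0.
  by congr (_ * _)%E; rewrite [RHS](fubini_tonelli1 _ mx2 x20).
have [-> _] := tonelli3 mu P mf2 f0.
under eq_integral do rewrite outer.
have x2fin : (\int[mu \X P]_p (x p ^+ 2)%:E)%E \is a fin_num.
  by rewrite ge0_fin_numE// integral_ge0.
rewrite -(fineK x2fin) ge0_integralZr//; last 2 first.
- exact/measurable_EFinP.
- by rewrite lee_fin fine_ge0// integral_ge0.
by rewrite integral_indic// setIT lte_mul_pinfty ?ltry// ge0_fin_numE.
Qed.

End mean_field_operator.

(** * Globally measurable versions of the data *)

Section product_almost_everywhere.
Context {R : realType} {d : measure_display} {Omega : measurableType d}.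
Variable P : probability Omega R.

Lemma ae_prod_fst (F : Omega * Omega -> Prop) : {ae (P \x P)%E, forall p, F p} ->
  {ae P, forall w, {ae P, forall w', F (w, w')}}.
Proof. exact: negligible_xsection. Qed.

Lemma ae_prod_snd (F : Omega * Omega -> Prop) : {ae (P \x P)%E, forall p, F p} ->
  {ae P, forall w, {ae P, forall w', F (w', w)}}.
Proof. exact: negligible_ysection. Qed.

End product_almost_everywhere.

Section jointly_measurable_versions.
Context {R : realType} {d : measure_display} {Omega : measurableType d}.
Variables (P : probability Omega R) (W : R -> {RV P >-> R}) (T : R) (n : nat).
Local Notation mu := (@lebesgue_measure R).
Local Notation RR := (measurableTypeR R).
Local Notation S := (`[0, T]%classic : set RR).
Local Notation Q := ((mu \X mu) \X P).

Lemma indic_mul_measurable d' (T' : measurableType d') (D : set T') (f : T' -> R) :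
  measurable D -> measurable_fun D f ->
  measurable_fun setT (fun x => \1_D x * f x).
Proof.
move=> mD mf; rewrite (_ : (fun x => _) = f \_ D).
  exact/(measurable_restrictT f mD).
apply/funext => x; rewrite patchE indicE.
by case: (x \in D); rewrite ?mul1r ?mul0r.
Qed.

(** The extension by zero turns a process on [0, T] into a function on the whole
    time axis. *)
Definition process (X : R -> Omega -> 'cV[R]_n) (i : 'I_n) (p : RR * Omega) : R :=
  \1_S p.1 * X p.1 p.2 i 0.

Lemma process_measurable X i :
  vmeasurable (`[0, T] `*` setT) (fun p : R * Omega => X p.1 p.2) ->
  measurable_fun setT (process X i).
Proof.
move=> mX.
rewrite (_ : process X i =
    fun p => \1_(S `*` setT) p * (fun p : R * Omega => X p.1 p.2 i 0) p).
  by apply: indic_mul_measurable (mX i); exact: measurableX.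
by apply/funext => p; rewrite /process !indicE in_setX in_setT andbT.
Qed.

Lemma process_Lfun2 X i : L2F W T X -> process X i \in Lfun (mu \X P) 2%:E.
Proof.
move=> [mX _ X2]; have mx := process_measurable i mX.
apply/Lfun2P; split => //.
have mx2 : measurable_fun setT (fun p => (process X i p ^+ 2)%:E).
  by apply/measurable_EFinP; exact: measurable_funX.
have x20 p : (0 <= (process X i p ^+ 2)%:E)%E by rewrite lee_fin sqr_ge0.
have mN : measurable_fun setT (fun p => (\sum_i process X i p ^+ 2)%:E).
  apply/measurable_EFinP; apply: measurable_sum => j; apply: measurable_funX.
  exact: process_measurable.
have N0 p : (0 <= (\sum_i process X i p ^+ 2)%:E)%E.
  by rewrite lee_fin; apply: sumr_ge0 => j _; exact: sqr_ge0.
apply: (@le_lt_trans _ _ (\int[mu \X P]_p (\sum_i process X i p ^+ 2)%:E)%E).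
  apply: ge0_le_integral => // p _; rewrite lee_fin (bigD1 i)//= lerDl.
  by apply: sumr_ge0 => j _; exact: sqr_ge0.
rewrite [ltLHS](fubini_tonelli2 _ mN N0); apply: le_lt_trans X2.
rewrite le_eqVlt; apply/orP; left; apply/eqP; apply: eq_integral => w _.
rewrite [RHS]integral_mkcond; apply: eq_integral => t _.
rewrite patchE /process/= indicE; case: ifPn => tS.
  by congr EFin; apply: eq_bigr => j _; rewrite mul1r.
by rewrite big1// => j _; rewrite mul0r expr0n.
Qed.

Definition kernel (Z : R -> R -> Omega -> 'cV[R]_n) (i : 'I_n)
    (q : RR * RR * Omega) : R :=
  \1_S q.1.1 * \1_S q.1.2 * Z q.1.1 q.1.2 q.2 i 0.

Lemma kernel_Lfun2 Y Z i : M2 W T Y Z -> kernel Z i \in Lfun Q 2%:E.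
Proof.
move=> [_ mZ _ Z2 _].
have mz j : measurable_fun setT (kernel Z j).
  rewrite (_ : kernel Z j = fun q => \1_((S `*` S) `*` setT) q *
      (fun q : (R * R) * Omega => Z q.1.1 q.1.2 q.2 j 0) q).
    apply: indic_mul_measurable (mZ j); apply: measurableX => //.
    exact: measurableX.
  by apply/funext => q; rewrite /kernel !indicE -natrM mulnb !in_setX in_setT andbT.
apply/Lfun2P; split => //.
pose N (q : RR * RR * Omega) := (\sum_i kernel Z i q ^+ 2)%:E.
have mN : measurable_fun setT N.
  apply/measurable_EFinP; apply: measurable_sum => j; exact: measurable_funX.
have N0 q : (0 <= N q)%E.
  by rewrite lee_fin; apply: sumr_ge0 => j _; exact: sqr_ge0.
apply: (@le_lt_trans _ _ (\int[Q]_q N q)%E).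
  apply: ge0_le_integral => //.
  - by move=> q _; rewrite lee_fin sqr_ge0.
  - by apply/measurable_EFinP; exact: measurable_funX.
  move=> q _; rewrite lee_fin (bigD1 i)//= lerDl.
  by apply: sumr_ge0 => j _; exact: sqr_ge0.
rewrite [ltLHS](fubini_tonelli2 (m1 := mu \X mu) _ mN N0).
apply: le_lt_trans Z2.
rewrite le_eqVlt; apply/orP; left; apply/eqP; apply: eq_integral => w _.
have mNw : measurable_fun setT (fun p : RR * RR => N (p, w)).
  by apply: measurableT_comp => //; exact: measurable_fun_pair.
rewrite [LHS](fubini_tonelli1 _ mNw (fun=> N0 _)).
rewrite [RHS]integral_mkcond; apply: eq_integral => t _.
rewrite patchE; case: ifPn => tS; last first.
  rewrite -[RHS](integral0 mu setT); apply: eq_integral => s _.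
  by rewrite /N big1// => j _; rewrite /kernel/= indicE (negbTE tS) !mul0r expr0n.
rewrite [RHS]integral_mkcond; apply: eq_integral => s _.
rewrite patchE; case: ifPn => sS.
  congr EFin; apply: eq_bigr => j _.
  by rewrite /kernel/= !indicE tS sS !mul1r.
rewrite /N big1// => j _.
by rewrite /kernel/= [\1_S s]indicE (negbTE sS) mulr0 mul0r expr0n.
Qed.

Local Notation D := (@triangle R T).

Lemma triangle_measurable : measurable (D : set (RR * RR)).
Proof.
rewrite (_ : D = [set p : RR * RR | 0 <= p.2] `&` [set p | p.2 <= p.1] `&`
    [set p | p.1 <= T]).
  by apply: measurableI; [apply: measurableI|]; exact: measurable_set_le.
by apply/seteqP; split => [p [/andP[]]|p [[? ?] ?]]//; split => //; apply/andP.
Qed.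

Lemma coef1_version A : Defs.coef1 W T A ->
  exists K (a : 'I_n -> 'I_n -> RR * RR * Omega -> R), [/\ 0 <= K,
    forall i j, measurable_fun setT (a i j),
    forall i j q, `|a i j q| <= K &
    forall i j p w, a i j (p, w) = \1_D p * A p.1 p.2 w i j].
Proof.
move=> [mA [K AK] _].
exists `|K|, (fun i j q => \1_D q.1 * A q.1.1 q.1.2 q.2 i j); split => //.
- move=> i j.
  rewrite (_ : (fun q => _) = fun q => \1_(D `*` setT) q *
      (fun q : (R * R) * Omega => A q.1.1 q.1.2 q.2 i j) q).
    apply: indic_mul_measurable (mA i j); apply: measurableX => //.
    exact: triangle_measurable.
  by apply/funext => q; rewrite !indicE in_setX in_setT andbT.
- move=> i j [[t s] w]; rewrite indicE; have [/set_mem tD|_] := boolP (_ \in _).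
    by rewrite mul1r (le_trans _ (ler_norm _))//; exact: AK.
  by rewrite mul0r normr0.
Qed.

(** The exceptional null set of the pairs of outcomes does not depend on the times,
    so that it can be discarded before integrating in time. *)
Lemma coef2_version C : Defs.coef2 W T C ->
  exists K (c : 'I_n -> 'I_n -> RR * RR * (Omega * Omega) -> R), [/\ 0 <= K,
    forall i j, measurable_fun setT (c i j),
    forall i j q, `|c i j q| <= K,
    forall i j p r, ~ D p -> c i j (p, r) = 0 &
    {ae (P \x P)%E, forall r, forall i j p, D p ->
       c i j (p, r) = C p.1 p.2 r.1 r.2 i j}].
Proof.
move=> [mC [K CK] _].
have /choice[g gP] : forall ij : 'I_n * 'I_n, exists g : RR * RR -> Omega -> Omega -> R,
    [/\ measurable_fun setT (fun q : RR * RR * (Omega * Omega) => g q.1 q.2.1 q.2.2),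
      (forall x w w', `|g x w w'| <= `|K|),
      (forall x w w', ~ D x -> g x w w' = 0) &
      exists2 N, (P \x P)%E.-negligible N &
        forall w w', ~ N (w, w') -> forall x, D x ->
          g x w w' = C x.1 x.2 w w' ij.1 ij.2].
  move=> [i j].
  apply: (@completed_product_version _ _ _ P _ (RR * RR)%type D
    (fun x w w' => C x.1 x.2 w w' i j) `|K|) => //.
  - exact: triangle_measurable.
  - by move=> [t s] w w' ts; rewrite (le_trans _ (ler_norm _))//; exact: CK.
  - exact: mC.
exists `|K|, (fun i j q => g (i, j) q.1 q.2.1 q.2.2); split => //.
- by move=> i j; have [] := gP (i, j).
- by move=> i j q; have [_ + _ _] := gP (i, j); exact.
- by move=> i j p r; have [_ _ + _] := gP (i, j); exact.
have : {ae (P \x P)%E, forall r, forall ij : 'I_n * 'I_n, forall p, D p ->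
    g ij p r.1 r.2 = C p.1 p.2 r.1 r.2 ij.1 ij.2}.
  apply: filter_forall => ij; have [_ _ _ [N nN gN]] := gP ij.
  by apply: negligibleS nN => r nr; apply: contrapT => nNr; apply: nr => p;
    apply: gN; rewrite -surjective_pairing.
by apply: filterS => r H i j p; exact: (H (i, j)).
Qed.

End jointly_measurable_versions.

(** * The equations tested against a random variable *)

Section drift_pairing.
Context {R : realType} {dT d : measure_display}.
Context {T : measurableType dT} {Omega : measurableType d}.
Variables (mu : {sigma_finite_measure set T -> \bar R}) (P : probability Omega R).

(** The drift, which is the inner integral of [f], is square integrable because the
    other terms of the equation are; Fubini then moves [eta] into it. *)
Lemma drift_pairing (eta x phi I : Omega -> R) (f : Omega * T -> R) :
  eta \in Lfun P 2%:E -> x \in Lfun P 2%:E -> phi \in Lfun P 2%:E ->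
  I \in Lfun P 2%:E ->
  (P \X mu).-integrable setT (EFin \o f) ->
  (P \X mu).-integrable setT (EFin \o (fun p => eta p.1 * f p)) ->
  {ae P, forall w, x w = phi w + \int[mu]_s f (w, s) + I w} ->
  \int[P]_w (eta w * phi w) = \int[P]_w (eta w * x w)
    - \int[P \X mu]_p (eta p.1 * f p) - \int[P]_w (eta w * I w).
Proof.
move=> eL xL pL IL i_f ief eqn.
have mf : measurable_fun setT f by apply/measurable_EFinP; exact: measurable_int i_f.
have meta := Lfun2_measurable eL; have mx := Lfun2_measurable xL.
have mphi := Lfun2_measurable pL; have mI := Lfun2_measurable IL.
pose D w := \int[mu]_s f (w, s).
have mD : measurable_fun setT D.
  exact: (@measurable_Rintegral_snd _ _ _ _ _ mu f).
have DL : D \in Lfun P 2%:E.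
  apply: (Lfun2_ae_eq (Lfun2B (Lfun2B xL pL) IL)) => //.
  by apply: filterS eqn => w ->; rewrite /D; ring.
have -> : \int[P \X mu]_p (eta p.1 * f p) = \int[P]_w (eta w * D w).
  exact: (Rintegral_fubini_weight meta i_f ief).
have ix := Lfun2_mul_integrable eL xL; have iD := Lfun2_mul_integrable eL DL.
have iI := Lfun2_mul_integrable eL IL.
have ixD : P.-integrable setT (EFin \o (fun w => eta w * x w - eta w * D w)).
  by have := integrableB measurableT ix iD; apply: eq_integrable.
rewrite -RintegralB// -RintegralB//; apply: Rintegral_ae_eq.
- by apply: measurable_funM.
- by apply: measurable_funB; [apply: measurable_funB|]; exact: measurable_funM.
by apply: filterS eqn => w ->; rewrite /D; ring.
Qed.

End drift_pairing.

Section pointwise_operators.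
Context {R : realType} {d : measure_display} {Omega : measurableType d}.
Variables (P : probability Omega R) (T : R) (n : nat).
Hypothesis P_complete : measure_is_complete P.
Local Notation mu := (@lebesgue_measure R).
Local Notation RR := (measurableTypeR R).
Local Notation S := (`[0, T]%classic : set RR).
Local Notation D := (@triangle R T).

Lemma triangle_fst (t s : R) : D (t, s) -> \1_S t = 1 :> R.
Proof.
move=> [/= /andP[s0 st] tT]; rewrite indicE mem_set//= in_itv/= tT andbT.
exact: le_trans s0 st.
Qed.

Lemma triangle_snd (t s : R) : D (t, s) -> \1_S s = 1 :> R.
Proof.
move=> [/= /andP[s0 st] tT]; rewrite indicE mem_set//= in_itv/= s0/=.
exact: le_trans st tT.
Qed.

Lemma mf_op_outside (I J : finType) (a : I -> J -> RR * RR * Omega -> R)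
    (c : I -> J -> RR * RR * (Omega * Omega) -> R) v i p w :
  (forall i j w, a i j (p, w) = 0) -> (forall i j r, c i j (p, r) = 0) ->
  mf_op P a c v i (p, w) = 0.
Proof.
move=> a0 c0; rewrite /mf_op /mf_at big1 ?add0r; last first.
  by move=> j _; rewrite a0 mul0r.
under eq_Rintegral do under eq_bigr do rewrite c0 mul0r.
by under eq_Rintegral do rewrite big1//; rewrite Rintegral_cst// mul0r.
Qed.

(** For almost every outcome [w], the versions of the coefficients agree with them
    at all times and for almost every second outcome, hence have the same integral
    over it. *)
Lemma forward_version (A : R -> R -> Omega -> 'M[R]_n)
    (C : R -> R -> Omega -> Omega -> 'M[R]_n) (X : R -> Omega -> 'cV[R]_n)
    (a : 'I_n -> 'I_n -> RR * RR * Omega -> R)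
    (c : 'I_n -> 'I_n -> RR * RR * (Omega * Omega) -> R) :
  (forall j, measurable_fun setT (process T X j)) ->
  (forall i j p w, a i j (p, w) = \1_D p * A p.1 p.2 w i j) ->
  (forall i j, measurable_fun setT (c i j)) ->
  {ae (P \x P)%E, forall r, forall i j p, D p ->
     c i j (p, r) = C p.1 p.2 r.1 r.2 i j} ->
  {ae P, forall w (t s : R) i, D (t, s) ->
    (A t s w *m X s w + Eprime P (fun w1 w2 => C t s w1 w2 *m X s w2) w) i 0 =
    mf_op P a c (fun j q => \1_S q.1.1 * process T X j (q.1.2, q.2)) i (t, s, w)}.
Proof.
move=> mX aE mc /ae_prod_fst; apply: filterS => w cE t s i ts.
have XE j w' : \1_S t * process T X j (s, w') = X s w' j 0.
  by rewrite /process (triangle_fst ts) (triangle_snd ts) !mul1r.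
rewrite /mf_op /mf_at /Eprime /vint !mxE/=; congr (_ + _).
  by apply: eq_bigr => j _; rewrite aE indicE mem_set// mul1r XE.
apply: (Rintegral_ae_eq_complete P_complete).
  apply: measurable_sum => j; apply: measurable_funM.
    by apply: measurableT_comp => //; exact: measurable_fun_pair.
  apply: measurable_funM => //.
  by apply: measurableT_comp => //; exact: measurable_fun_pair.
by apply: filterS cE => w' cE; rewrite mxE; apply: eq_bigr => j _; rewrite cE// XE.
Qed.

Lemma sum_bool_pair (F : bool * 'I_n -> R) :
  \sum_k F k = \sum_i F (false, i) + \sum_i F (true, i).
Proof.
rewrite (eq_bigr (fun k => F (k.1, k.2))) => [|[]//].
by rewrite -(pair_bigA _ (fun b i => F (b, i)))/= big_bool addrC.
Qed.

(** A drift part, indexed by [false], and a diffusion part, indexed by [true], are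
    stacked into a single vector: the pair of [Y] and [Z] is then paired at once with
    the drift and the diffusion of the forward equation. *)
Definition by_part (E : Type) (f0 f1 : 'I_n -> E) (k : bool * 'I_n) : E :=
  if k.1 then f1 k.2 else f0 k.2.

Lemma backward_version (A0 A1 : R -> R -> Omega -> 'M[R]_n)
    (C0 C1 : R -> R -> Omega -> Omega -> 'M[R]_n) (Y : R -> Omega -> 'cV[R]_n)
    (Z : R -> R -> Omega -> 'cV[R]_n)
    (a0 a1 : 'I_n -> 'I_n -> RR * RR * Omega -> R)
    (c0 c1 : 'I_n -> 'I_n -> RR * RR * (Omega * Omega) -> R) :
  (forall j, measurable_fun setT (process T Y j)) ->
  (forall j, measurable_fun setT (kernel T Z j)) ->
  (forall i j p w, a0 i j (p, w) = \1_D p * A0 p.1 p.2 w i j) ->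
  (forall i j p w, a1 i j (p, w) = \1_D p * A1 p.1 p.2 w i j) ->
  (forall i j, measurable_fun setT (c0 i j)) ->
  (forall i j, measurable_fun setT (c1 i j)) ->
  {ae (P \x P)%E, forall r, forall i j p, D p ->
     c0 i j (p, r) = C0 p.1 p.2 r.1 r.2 i j} ->
  {ae (P \x P)%E, forall r, forall i j p, D p ->
     c1 i j (p, r) = C1 p.1 p.2 r.1 r.2 i j} ->
  {ae P, forall w (t s : R) j, D (s, t) ->
    ((A0 s t w)^T *m Y s w + (A1 s t w)^T *m Z s t w +
       Estar P (fun w1 w2 => (C0 s t w1 w2)^T *m Y s w1
                           + (C1 s t w1 w2)^T *m Z s t w1) w) j 0 =
    mf_op P (tr_local (by_part a0 a1)) (tr_mean (by_part c0 c1))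
      (by_part (fun i q => \1_S q.1.2 * process T Y i (q.1.1, q.2)) (kernel T Z))
      j (s, t, w)}.
Proof.
move=> mY mZ a0E a1E mc0 mc1 /ae_prod_snd c0E /ae_prod_snd c1E.
apply: filterS2 c0E c1E => w c0E c1E t s j st.
have YE i w' : \1_S t * process T Y i (s, w') = Y s w' i 0.
  by rewrite /process (triangle_fst st) (triangle_snd st) !mul1r.
have ZE i w' : kernel T Z i (s, t, w') = Z s t w' i 0.
  by rewrite /kernel (triangle_fst st) (triangle_snd st) !mul1r.
rewrite /mf_op /mf_at /Estar /vint !mxE/=; congr (_ + _).
  rewrite sum_bool_pair /by_part/tr_local/=; congr (_ + _); apply: eq_bigr => i _.
    by rewrite mxE a0E indicE mem_set// mul1r YE.
  by rewrite mxE a1E indicE mem_set// mul1r ZE.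
apply: (Rintegral_ae_eq_complete P_complete).
  apply: measurable_sum => -[b i]; rewrite /by_part /tr_mean/=.
  apply: measurable_funM.
    have mpr : measurable_fun setT (fun w' : Omega => ((s : RR, t : RR), (w', w))).
      by apply: measurable_fun_pair => //; exact: measurable_fun_pair.
    by case: b; [exact: (measurableT_comp (mc1 i j) mpr)
                |exact: (measurableT_comp (mc0 i j) mpr)].
  case: b.
    by apply: measurableT_comp => //; exact: measurable_fun_pair.
  apply: measurable_funM => /=; first exact: measurable_cst.
  by apply: measurableT_comp => //; exact: measurable_fun_pair.
apply: filterS2 c0E c1E => w' c0E c1E; rewrite !mxE.
rewrite sum_bool_pair /by_part/tr_mean/=; congr (_ + _); apply: eq_bigr => i _.
  by rewrite mxE c0E// YE.
by rewrite mxE c1E// ZE.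
Qed.

End pointwise_operators.

(** * Duality *)

Section time_pairing.
Context {R : realType} {d : measure_display} {Omega : measurableType d}.
Variables (P : probability Omega R) (W : R -> {RV P >-> R}) (T : R) (n : nat).
Local Notation mu := (@lebesgue_measure R).
Local Notation RR := (measurableTypeR R).
Local Notation S := (`[0, T]%classic : set RR).

Definition pairing (r s : 'I_n -> RR * Omega -> R) (t : R) : R :=
  \int[P]_w (\sum_j r j (t, w) * s j (t, w)).

Lemma pairingC r s t : pairing r s t = pairing s r t.
Proof.
by apply: eq_Rintegral => w _; apply: eq_bigr => j _; rewrite mulrC.
Qed.

Lemma pairing_outside X r t : ~ (0 <= t <= T) -> pairing (process T X) r t = 0.
Proof.
move=> nt; rewrite /pairing (_ : (fun w => _) = cst 0); last first.
  apply/funext => w; rewrite big1// => j _.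
  by rewrite /process indicE memNset ?mul0r//= in_itv.
by rewrite Rintegral_cst// mul0r.
Qed.

Lemma expectation_time_integral X psi : L2F W T X -> L2F W T psi ->
  mu.-integrable setT (EFin \o pairing (process T X) (process T psi)) /\
  ('E_P[fun w => (\int[mu]_(t in `[0, T]) dotv (X t w) (psi t w))%R])%E =
    (\int[mu]_t pairing (process T X) (process T psi) t)%:E.
Proof.
move=> XL psiL.
pose h (p : RR * Omega) := \sum_j process T X j p * process T psi j p.
have ih : (mu \X P).-integrable setT (EFin \o h).
  apply: (Rintegral_sum _ (fun j => _)).1 => j.
  exact: Lfun2_mul_integrable (process_Lfun2 j XL) (process_Lfun2 j psiL).
have [ih' Ih] := swap_integral (m1 := P) (m2 := mu) ih.
split; first exact: (Rintegral_fubini_integrable (m1 := mu) (m2 := P) ih).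
rewrite -[X in X%:E](Rintegral_fubini (m1 := mu) (m2 := P) ih).
rewrite -[X in X%:E]Ih [X in X%:E](Rintegral_fubini (m1 := P) (m2 := mu) ih').
rewrite unlock /Rintegral fineK; last first.
  apply: integrable_fin_num => //.
  exact: (Rintegral_fubini_integrable (m1 := P) (m2 := mu) ih').
apply: eq_integral => w _; congr (_%:E).
rewrite -/(Rintegral _ _ _) -/(Rintegral _ _ _) Rintegral_mkcond.
apply: eq_Rintegral => t _; rewrite patchE mem_setE in_itv/= /h /dotv.
case: ifPn => [tT|nt].
  apply: eq_bigr => j _.
  by rewrite /process/= indicE mem_set ?mul1r//= in_itv.
rewrite big1// => j _.
by rewrite /process/= indicE memNset ?mul0r//= in_itv; exact/negP.
Qed.

End time_pairing.

Section duality.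
Context {R : realType} {d : measure_display} {Omega : measurableType d}.
Variables (P : probability Omega R) (W : R -> {RV P >-> R}) (T : R) (n : nat).
Variables (A0 A1 : R -> R -> Omega -> 'M[R]_n)
  (C0 C1 : R -> R -> Omega -> Omega -> 'M[R]_n)
  (phi psi X Y : R -> Omega -> 'cV[R]_n) (Z : R -> R -> Omega -> 'cV[R]_n).
Hypothesis P_complete : measure_is_complete P.
Hypothesis W_brownian : brownian_motion W.
Hypothesis phi_L2 : L2F W T phi.
Hypothesis psi_L2 : L2F W T psi.
Hypothesis X_sol : MF_FSVIE_solution W T A0 A1 C0 C1 phi X.
Hypothesis YZ_sol : MF_BSVIE_Msolution W T A0 A1 C0 C1 psi Y Z.
Local Notation mu := (@lebesgue_measure R).
Local Notation RR := (measurableTypeR R).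
Local Notation S := (`[0, T]%classic : set RR).
Local Notation D := (@triangle R T).
Local Notation Q := ((mu \X mu) \X P).

Variables (K : R) (a0 a1 : 'I_n -> 'I_n -> RR * RR * Omega -> R)
  (c0 c1 : 'I_n -> 'I_n -> RR * RR * (Omega * Omega) -> R).
Hypothesis K0 : 0 <= K.
Hypothesis ma0 : forall i j, measurable_fun setT (a0 i j).
Hypothesis ma1 : forall i j, measurable_fun setT (a1 i j).
Hypothesis mc0 : forall i j, measurable_fun setT (c0 i j).
Hypothesis mc1 : forall i j, measurable_fun setT (c1 i j).
Hypothesis a0K : forall i j q, `|a0 i j q| <= K.
Hypothesis a1K : forall i j q, `|a1 i j q| <= K.
Hypothesis c0K : forall i j q, `|c0 i j q| <= K.
Hypothesis c1K : forall i j q, `|c1 i j q| <= K.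
Hypothesis a0E : forall i j p w, a0 i j (p, w) = \1_D p * A0 p.1 p.2 w i j.
Hypothesis a1E : forall i j p w, a1 i j (p, w) = \1_D p * A1 p.1 p.2 w i j.
Hypothesis c0D : forall i j p r, ~ D p -> c0 i j (p, r) = 0.
Hypothesis c1D : forall i j p r, ~ D p -> c1 i j (p, r) = 0.
Hypothesis c0E : {ae (P \x P)%E, forall r, forall i j p, D p ->
  c0 i j (p, r) = C0 p.1 p.2 r.1 r.2 i j}.
Hypothesis c1E : {ae (P \x P)%E, forall r, forall i j p, D p ->
  c1 i j (p, r) = C1 p.1 p.2 r.1 r.2 i j}.

Let x := process T X.
Let y := process T Y.
Let f := process T phi.
Let g := process T psi.
Let z := kernel T Z.

Let xL j : x j \in Lfun (mu \X P) 2%:E.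
Proof. exact: process_Lfun2 X_sol.1. Qed.
Let yL j : y j \in Lfun (mu \X P) 2%:E.
Proof. by have [[yL2 _ _ _ _] _ _] := YZ_sol; exact: process_Lfun2 yL2. Qed.
Let fL j : f j \in Lfun (mu \X P) 2%:E.
Proof. exact: process_Lfun2 phi_L2. Qed.
Let gL j : g j \in Lfun (mu \X P) 2%:E.
Proof. exact: process_Lfun2 psi_L2. Qed.
Let zL i : z i \in Lfun Q 2%:E.
Proof. by have [M2YZ _ _] := YZ_sol; exact: kernel_Lfun2 M2YZ. Qed.

Let mS : measurable S. Proof. exact: measurable_itv. Qed.
Let muS : (mu S < +oo)%E.
Proof. by rewrite lebesgue_measure_itv/=; case: ifPn => _; rewrite ?ltry// -EFinB ltry. Qed.

Let a := by_part a0 a1.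
Let c := by_part c0 c1.
(* At the times [(t, s)], [v] is the argument of the forward operator and [vs]
   the factor [X t] of its dual pairing, [u] is the pair of [Y t] and [Z t s], and
   [bw] is the backward drift integrand read with its times exchanged. *)
Let v j (q : RR * RR * Omega) : R := \1_S q.1.1 * x j (q.1.2, q.2).
Let vs j (q : RR * RR * Omega) : R := \1_S q.1.2 * x j (q.1.1, q.2).
Let ys i (q : RR * RR * Omega) : R := \1_S q.1.2 * y i (q.1.1, q.2).
Let u := by_part ys z.
Let fw := mf_op P a c v.
Let bw j (q : RR * RR * Omega) : R :=
  mf_op P (tr_local a) (tr_mean c) u j (q.1.2, q.1.1, q.2).

Let ma k j : measurable_fun setT (a k j).
Proof. by case: k => -[] i; rewrite /a /by_part/=. Qed.
Let mc k j : measurable_fun setT (c k j).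
Proof. by case: k => -[] i; rewrite /c /by_part/=. Qed.
Let aK k j q : `|a k j q| <= K.
Proof. by case: k => -[] i; rewrite /a /by_part/=. Qed.
Let cK k j q : `|c k j q| <= K.
Proof. by case: k => -[] i; rewrite /c /by_part/=. Qed.

Let vL j : v j \in Lfun Q 2%:E.
Proof. exact: process_kernel_Lfun2. Qed.
Let vsL j : vs j \in Lfun Q 2%:E.
Proof. exact: (swap_times_Lfun2 (vL j)). Qed.
Let ysL i : ys i \in Lfun Q 2%:E.
Proof. exact: (swap_times_Lfun2 (process_kernel_Lfun2 mS muS (yL i))). Qed.
Let uL k : u k \in Lfun Q 2%:E.
Proof. by case: k => -[] i; [exact: zL|exact: ysL]. Qed.
Let fwL k : fw k \in Lfun Q 2%:E.
Proof. exact: (mf_op_Lfun2 K0 ma aK mc cK). Qed.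
Let bwL j : bw j \in Lfun Q 2%:E.
Proof.
have := mf_op_Lfun2 K0 (fun j i => ma i j) (fun j i => aK i j)
  (tr_mean_measurable mc) (fun j i q => cK i j _) j uL.
by move/swap_times_Lfun2.
Qed.

Let F q := \sum_k u k q * fw k q.
Let G q := \sum_j vs j q * bw j q.

Let iF : Q.-integrable setT (EFin \o F).
Proof. exact: sum_mul_integrable uL fwL. Qed.
Let iG : Q.-integrable setT (EFin \o G).
Proof. exact: sum_mul_integrable vsL bwL. Qed.

Let slice (h : RR * RR * Omega -> R) (t : R) : R :=
  \int[P \X mu]_p h (t, p.2, p.1).

(** The adjoint relation at fixed times is integrated over all of them, and the
    times are exchanged on the side of the backward operator. *)
Lemma operator_duality : \int[mu]_t slice F t = \int[mu]_t slice G t.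
Proof.
have [_ <-] := time_slices iF; have [_ <-] := time_slices iG.
rewrite [LHS](mf_op_adjoint K0 ma aK mc cK uL vL).
have i1 := sum_mul_integrable vL (fun j => mf_op_Lfun2 K0 (fun j i => ma i j)
  (fun j i => aK i j) (tr_mean_measurable mc) (fun j i q => cK i j _) j uL).
by have [_ <-] := swap_times_integral i1.
Qed.

Let fw_outside k t s w : ~ D (t, s) -> fw k (t, s, w) = 0.
Proof.
move=> nD; apply: mf_op_outside => [[[] i] j w'|[[] i] j r]; rewrite /a /c /by_part/=.
- by rewrite a1E indicE memNset// mul0r.
- by rewrite a0E indicE memNset// mul0r.
- exact: c1D.
- exact: c0D.
Qed.

Let bw_outside j t s w : ~ D (s, t) -> bw j (t, s, w) = 0.
Proof.
move=> nD; apply: mf_op_outside => [j' [[] i] w'|j' [[] i] r];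
  rewrite /a /c /tr_local /tr_mean /by_part/=.
- by rewrite a1E indicE memNset// mul0r.
- by rewrite a0E indicE memNset// mul0r.
- exact: c1D.
- exact: c0D.
Qed.

Let fw0_version : {ae P, forall w (t s : R) i, D (t, s) ->
  (A0 t s w *m X s w + Eprime P (fun w1 w2 => C0 t s w1 w2 *m X s w2) w) i 0 =
  fw (false, i) (t, s, w)}.
Proof. exact: (forward_version P_complete (fun j => Lfun2_measurable (xL j)) a0E mc0 c0E). Qed.

Let fw1_version : {ae P, forall w (t s : R) i, D (t, s) ->
  (A1 t s w *m X s w + Eprime P (fun w1 w2 => C1 t s w1 w2 *m X s w2) w) i 0 =
  fw (true, i) (t, s, w)}.
Proof. exact: (forward_version P_complete (fun j => Lfun2_measurable (xL j)) a1E mc1 c1E). Qed.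

Let bw_version : {ae P, forall w (t s : R) j, D (s, t) ->
  ((A0 s t w)^T *m Y s w + (A1 s t w)^T *m Z s t w +
     Estar P (fun w1 w2 => (C0 s t w1 w2)^T *m Y s w1
                         + (C1 s t w1 w2)^T *m Z s t w1) w) j 0 =
  bw j (t, s, w)}.
Proof.
exact: (backward_version P_complete (fun j => Lfun2_measurable (yL j))
  (fun j => Lfun2_measurable (zL j)) a0E a1E mc0 mc1 c0E c1E).
Qed.

Let ae_imply2 (A B C : RR -> Prop) : (forall t, A t -> B t -> C t) ->
  {ae mu, forall t, A t} -> {ae mu, forall t, B t} -> {ae mu, forall t, C t}.
Proof.
move=> ABC hA hB.
exact: (@filterS2 _ _ (ae_filter_ringOfSetsType mu) A B C ABC hA hB).
Qed.

Let ae_and (A B : RR -> Prop) :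
  {ae mu, forall t, A t} -> {ae mu, forall t, B t} -> {ae mu, forall t, A t /\ B t}.
Proof. by apply: ae_imply2. Qed.

Let slices_Lfun2 (r : 'I_n -> RR * Omega -> R) :
  (forall j, r j \in Lfun (mu \X P) 2%:E) ->
  {ae mu, forall t, forall j, (fun w => r j (t, w)) \in Lfun P 2%:E}.
Proof.
move=> rL; apply: filter_forall => j.
exact: (Lfun2_section (m1 := mu) (m2 := P) (rL j)).
Qed.

Let kernel_slices_Lfun2 (k : finType) (r : k -> RR * RR * Omega -> R) :
  (forall j, r j \in Lfun Q 2%:E) ->
  {ae mu, forall t, forall j,
     (fun p => r j (t, p.2, p.1)) \in Lfun (P \X mu) 2%:E}.
Proof.
by move=> rL; apply: filter_forall => j; exact: time_slice_Lfun2.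
Qed.

Let pairingE (r s : 'I_n -> RR * Omega -> R) t :
  (forall j, (fun w => r j (t, w)) \in Lfun P 2%:E) ->
  (forall j, (fun w => s j (t, w)) \in Lfun P 2%:E) ->
  pairing P r s t = \sum_j \int[P]_w (r j (t, w) * s j (t, w)).
Proof.
by move=> rL sL; rewrite /pairing (Rintegral_sum _ (fun j =>
  Lfun2_mul_integrable (rL j) (sL j))).2.
Qed.

Let onesL : (fun p : Omega * RR => \1_S p.2) \in Lfun (P \X mu) 2%:E.
Proof.
have [i1 _] := tensor_integral (m1 := P) (m2 := mu)
  (finite_measure_integrable_cst P 1 measurableT)
  (integrable_indic_itv (0 : R) T true false).
apply: (Lfun2_dominated _ i1).
- by apply: measurableT_comp => //; exact: measurable_indic.
- by move=> p; rewrite mul1r indicE; case: (_ \in _); rewrite ?expr1n ?expr0n.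
Qed.

Let onS (t : R) : 0 <= t <= T -> \1_S t = 1 :> R.
Proof. by move=> tT; rewrite indicE mem_set//= in_itv. Qed.

(** The forward equation at time [t] is tested against [Y t]: the drift gives the
    terms of [slice F] that contain [Y t], and the isometry, applied to the
    representation of [Y t] by the Ito integral of [Z t], gives those with [Z t]. *)
Lemma forward_identity :
  {ae mu, forall t : R, 0 <= t <= T -> pairing P y f t = pairing P y x t - slice F t}.
Proof.
have [_ X_eq] := X_sol; have [_ _ Y_repr] := YZ_sol.
have H1 := ae_and (slices_Lfun2 xL) (ae_and (slices_Lfun2 yL) (slices_Lfun2 fL)).
have H2 := ae_and (kernel_slices_Lfun2 uL) (kernel_slices_Lfun2 fwL).
apply: (ae_imply2 _ (ae_and H1 H2) (ae_and X_eq Y_repr)).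
move=> t [[xLt [yLt fLt]] [uLt fwLt]] [HX HY] tT.
have [I [hI eI]] := HX tT; have [J [hJ eJ]] := HY tT.
have t0 : 0 <= t by case/andP: tT.
have t1 := onS tT.
have inD s : 0 <= s <= t -> D (t, s) by move=> st; split => //; case/andP: tT.
have notD s : ~ (0 <= s <= t) -> ~ D (t, s) by move=> nst [].
have fwS k p : \1_S p.2 * fw k (t, p.2, p.1) = fw k (t, p.2, p.1).
  have [st|nst] := pselect (D (t, p.2)); last by rewrite fw_outside// mulr0.
  by rewrite (triangle_snd st) mul1r.
have ver_fw i : version P 0 t (fun s w => (A1 t s w *m X s w +
    Eprime P (fun w1 w2 => C1 t s w1 w2 *m X s w2) w) i 0)
    (fun s w => fw (true, i) (t, s, w)).
  split; first exact: Lfun2_measurable (fwLt (true, i)).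
  by apply: filterS fw1_version => w ver s st; apply: ver; exact: inD.
have ver_z i : version P 0 t (fun s w => Z t s w i 0) (fun s w => z i (t, s, w)).
  split; first exact: Lfun2_measurable (uLt (true, i)).
  apply: aeW => w s st; rewrite /z /kernel/= t1 onS ?mul1r//.
  by case/andP: st => s0 /le_trans -> //; [rewrite s0|case/andP: tT].
have [IL JL] : (forall i, (fun w => I w i 0) \in Lfun P 2%:E) /\
    (forall i, (fun w => J w i 0) \in Lfun P 2%:E).
  split=> i; first exact: (ito_Lfun2 P_complete W_brownian (lexx 0) (ver_fw i) (hI i)).1.
  exact: (ito_Lfun2 P_complete W_brownian (lexx 0) (ver_z i) (hJ i)).1.
have yI i : \int[P]_w (y i (t, w) * I w i 0) =
    \int[P \X mu]_p (u (true, i) (t, p.2, p.1) * fw (true, i) (t, p.2, p.1)).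
  (* The constant [E (Y t)] belongs to the past of time 0. *)
  have I_mean0 : \int[P]_w I w i 0 = 0.
    have one_past : past W 0 (fun=> 1) by exact: measurable_cst.
    have one_L2 : (fun=> 1) \in Lfun P 2%:E by exact: Lfun2_one.
    rewrite -[RHS](ito_past_orthogonal P_complete W_brownian (lexx 0)
      (ver_fw i) (hI i) one_past one_L2).
    by apply: eq_Rintegral => w _; rewrite mul1r.
  pose m := \int[P]_w Y t w i 0.
  have JI := ito_isometry P_complete W_brownian (lexx 0)
    (ver_z i) (hJ i) (ver_fw i) (hI i).
  transitivity (\int[P]_w (m * I w i 0 + J w i 0 * I w i 0)).
    apply: Rintegral_ae_eq.
    - apply: measurable_funM; exact: Lfun2_measurable.
    - by apply: measurable_funD; apply: measurable_funM => //;
        exact: Lfun2_measurable.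
    by apply: filterS eJ => w; rewrite /y /process/= t1 mul1r => ->;
      rewrite mxE [in LHS]mxE mulrDl.
  have imI : P.-integrable setT (EFin \o (fun w => m * I w i 0)).
    exact: Lfun2_integrable (Lfun2Z m (IL i)).
  have iJI := Lfun2_mul_integrable (JL i) (IL i).
  rewrite RintegralD// RintegralZl//; last exact: Lfun2_integrable.
  rewrite I_mean0 mulr0 add0r JI; apply: eq_Rintegral => -[w s] _.
  rewrite /strip/=; have [st|nst] := pselect (0 <= s <= t).
    by rewrite indicE mem_set ?mul1r//= in_itv.
  by rewrite fw_outside ?mulr0//; exact: notD.
have drift i : \int[P]_w (y i (t, w) * f i (t, w)) =
    \int[P]_w (y i (t, w) * x i (t, w))
    - \int[P \X mu]_p (u (false, i) (t, p.2, p.1) * fw (false, i) (t, p.2, p.1))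
    - \int[P]_w (y i (t, w) * I w i 0).
  (* Outside the triangle the operator vanishes, so that the indicator carried by
     [u] can be dropped. *)
  have uE p : u (false, i) (t, p.2, p.1) * fw (false, i) (t, p.2, p.1) =
      y i (t, p.1) * fw (false, i) (t, p.2, p.1).
    by rewrite -[in RHS]fwS /u /by_part /ys/=; ring.
  have iu := Lfun2_mul_integrable (uLt (false, i)) (fwLt (false, i)).
  under [X in _ - X - _]eq_Rintegral do rewrite uE.
  apply: drift_pairing => //.
  - have := Lfun2_mul_integrable onesL (fwLt (false, i)).
    by apply: eq_integrable => // p _; rewrite /= fwS.
  - by apply: eq_integrable iu => // p _; rewrite /= uE.
  apply: filterS2 eI fw0_version => w eIw ver.
  rewrite /x /f /process/= t1 !mul1r eIw !mxE; congr (_ + _ + _).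
  rewrite Rintegral_mkcond; apply: eq_Rintegral => s _.
  rewrite patchE mem_setE in_itv/=; case: ifPn => [|/negP] st.
    by rewrite ver//; exact: inD.
  by rewrite fw_outside//; exact: notD.
rewrite !pairingE// /slice /F.
rewrite (Rintegral_sum _ (fun k => Lfun2_mul_integrable (uLt k) (fwLt k))).2.
rewrite sum_bool_pair opprD addrA -!sumrB; apply: eq_bigr => i _.
by rewrite drift yI.
Qed.

(** Testing the backward equation at time [t] against [X t], which is known at
    that time, makes the stochastic integral over [t, T] disappear. *)
Lemma backward_identity :
  {ae mu, forall t : R, 0 <= t <= T -> pairing P x g t = pairing P x y t - slice G t}.
Proof.
have [[_ X_adapted _] _] := X_sol; have [_ Y_eq _] := YZ_sol.
have H1 := ae_and (slices_Lfun2 xL) (ae_and (slices_Lfun2 yL) (slices_Lfun2 gL)).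
have H2 := ae_and (kernel_slices_Lfun2 vsL) (kernel_slices_Lfun2 bwL).
have H3 := ae_and (kernel_slices_Lfun2 zL) Y_eq.
apply: (ae_imply2 _ (ae_and H1 H2) H3).
move=> t [[xLt [yLt gLt]] [vsLt bwLt]] [zLt HY] tT; have [I [hI eI]] := HY tT.
have t0 : 0 <= t by case/andP: tT.
have t1 := onS tT.
have inD s : t <= s <= T -> D (s, t).
  by move=> /andP[ts sT]; split => //=; rewrite t0.
have notD s : ~ (t <= s <= T) -> ~ D (s, t).
  by move=> nts [/= /andP[_ ts] sT]; apply: nts; rewrite ts.
have bwS j p : \1_S p.2 * bw j (t, p.2, p.1) = bw j (t, p.2, p.1).
  have [st|nst] := pselect (D (p.2, t)); last by rewrite bw_outside// mulr0.
  by rewrite (triangle_fst st) mul1r.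
have ver_z i : version P t T (fun s w => Z t s w i 0) (fun s w => z i (t, s, w)).
  split; first exact: Lfun2_measurable (zLt i).
  apply: aeW => w s /andP[ts sT]; rewrite /z /kernel/= t1 onS ?mul1r//.
  by rewrite sT (le_trans t0).
have IL i : (fun w => I w i 0) \in Lfun P 2%:E.
  exact: (ito_Lfun2 P_complete W_brownian t0 (ver_z i) (hI i)).1.
have xI j : \int[P]_w (x j (t, w) * I w j 0) = 0.
  apply: (ito_past_orthogonal P_complete W_brownian t0 (ver_z j) (hI j)) => //.
  rewrite (_ : (fun w => x j (t, w)) = (fun w => X t w j 0)).
    exact: (X_adapted t tT).
  by apply/funext => w; rewrite /x /process/= t1 mul1r.
have drift j : \int[P]_w (x j (t, w) * g j (t, w)) =
    \int[P]_w (x j (t, w) * y j (t, w))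
    - \int[P \X mu]_p (vs j (t, p.2, p.1) * bw j (t, p.2, p.1))
    - \int[P]_w (x j (t, w) * (- 1 * I w j 0)).
  have vsE p : vs j (t, p.2, p.1) * bw j (t, p.2, p.1) =
      x j (t, p.1) * bw j (t, p.2, p.1).
    by rewrite -[in RHS]bwS /vs/=; ring.
  have iv := Lfun2_mul_integrable (vsLt j) (bwLt j).
  under [X in _ - X - _]eq_Rintegral do rewrite vsE.
  apply: drift_pairing => //.
  - exact: Lfun2Z.
  - have := Lfun2_mul_integrable onesL (bwLt j).
    by apply: eq_integrable => // p _; rewrite /= bwS.
  - by apply: eq_integrable iv => // p _; rewrite /= vsE.
  apply: filterS2 eI bw_version => w eIw ver.
  rewrite /y /g /process/= t1 !mul1r eIw !mxE mulN1r; congr (_ + _ - _).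
  rewrite Rintegral_mkcond; apply: eq_Rintegral => s _.
  rewrite patchE mem_setE in_itv/=; case: ifPn => [|/negP] st.
    by rewrite -ver ?mxE//; exact: inD.
  by rewrite bw_outside//; exact: notD.
rewrite !pairingE// /slice /G.
rewrite (Rintegral_sum _ (fun k => Lfun2_mul_integrable (vsLt k) (bwLt k))).2.
rewrite -!sumrB; apply: eq_bigr => j _; rewrite drift.
under [X in _ - _ - X]eq_Rintegral do rewrite mulrCA.
by rewrite RintegralZl ?xI ?mulr0 ?subr0//; exact: Lfun2_mul_integrable.
Qed.

(** The right-hand sides of the two identities have the same integral over [0, T]:
    [pairing] is symmetric and the slices are dual to each other. *)
Lemma pairing_duality :
  \int[mu]_t pairing P x g t = \int[mu]_t pairing P y f t.
Proof.
have [[YL _ _ _ _] _ _] := YZ_sol.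
have [ixg _] := expectation_time_integral X_sol.1 psi_L2.
have [iyf _] := expectation_time_integral YL phi_L2.
have [ixy _] := expectation_time_integral X_sol.1 YL.
have [iyx _] := expectation_time_integral YL X_sol.1.
have [isF _] := time_slices iF; have [isG _] := time_slices iG.
have out t : ~ (0 <= t <= T) -> slice F t = 0 /\ slice G t = 0.
  move=> nt; split.
    rewrite /slice (_ : (fun p => _) = cst 0) ?Rintegral_cst ?mul0r//.
    apply/funext => p; rewrite /F big1// => k _; rewrite fw_outside ?mulr0//.
    by move=> [/= /andP[s0 st] tT]; apply: nt; rewrite tT (le_trans s0).
  rewrite /slice (_ : (fun p => _) = cst 0) ?Rintegral_cst ?mul0r//.
  apply/funext => p; rewrite /G big1// => k _; rewrite bw_outside ?mulr0//.
  by move=> [/= /andP[t0 ts] sT]; apply: nt; rewrite t0 (le_trans ts).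
have meas (h : RR -> R) : mu.-integrable setT (EFin \o h) -> measurable_fun setT h.
  by move=> ih; apply/measurable_EFinP; exact: measurable_int ih.
have integrate (h k l : RR -> R) : mu.-integrable setT (EFin \o h) ->
    mu.-integrable setT (EFin \o k) -> mu.-integrable setT (EFin \o l) ->
    {ae mu, forall t, h t = k t - l t} ->
    \int[mu]_t h t = \int[mu]_t k t - \int[mu]_t l t.
  move=> ih ik il hkl; rewrite -RintegralB//; apply: Rintegral_ae_eq => //.
    exact: meas.
  by apply: measurable_funB; exact: meas.
have -> : \int[mu]_t pairing P x g t =
    \int[mu]_t pairing P x y t - \int[mu]_t slice G t.
  apply: integrate => //.
  apply: (@filterS _ _ (ae_filter_ringOfSetsType mu)) backward_identity => t h.
  have [tT|nt] := pselect (0 <= t <= T); first exact: h.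
  by rewrite !pairing_outside// (out _ nt).2 subr0.
have -> : \int[mu]_t pairing P y f t =
    \int[mu]_t pairing P y x t - \int[mu]_t slice F t.
  apply: integrate => //.
  apply: (@filterS _ _ (ae_filter_ringOfSetsType mu)) forward_identity => t h.
  have [tT|nt] := pselect (0 <= t <= T); first exact: h.
  by rewrite !pairing_outside// (out _ nt).1 subr0.
rewrite operator_duality; congr (_ - _).
by apply: eq_Rintegral => t _; exact: pairingC.
Qed.

End duality.


Theorem theorem4p1 (R : realType) (d : measure_display)
    (Omega : measurableType d) (P : probability Omega R)
    (W : R -> {RV P >-> R}) (T : R) (n : nat)
    (A0 A1 : R -> R -> Omega -> 'M[R]_n)
    (C0 C1 : R -> R -> Omega -> Omega -> 'M[R]_n)
    (phi psi X Y : R -> Omega -> 'cV[R]_n)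
    (Z : R -> R -> Omega -> 'cV[R]_n)
    (P_complete : measure_is_complete P)
    (W_brownian : brownian_motion W)
    (T_gt0 : 0 < T)
    (coefL1 : L1 W T A0 A1 C0 C1)
    (phi_L2 : L2F W T phi)
    (psi_L2 : L2F W T psi)
    (X_sol : MF_FSVIE_solution W T A0 A1 C0 C1 phi X)
    (YZ_sol : MF_BSVIE_Msolution W T A0 A1 C0 C1 psi Y Z) :
  ('E_P[fun w =>
        (\int[lebesgue_measure]_(t in `[0, T]) dotv (X t w) (psi t w))%R] =
   'E_P[fun w =>
        (\int[lebesgue_measure]_(t in `[0, T]) dotv (Y t w) (phi t w))%R])%E.
Proof.
have [A0L A1L C0L C1L] := coefL1.
have [K1 [a0 [K1_ge0 ma0 a0K a0E]]] := coef1_version A0L.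
have [K2 [a1 [K2_ge0 ma1 a1K a1E]]] := coef1_version A1L.
have [K3 [c0 [K3_ge0 mc0 c0K c0D c0E]]] := coef2_version C0L.
have [K4 [c1 [K4_ge0 mc1 c1K c1D c1E]]] := coef2_version C1L.
have [[YL _ _ _ _] _ _] := YZ_sol.
rewrite (expectation_time_integral X_sol.1 psi_L2).2.
rewrite (expectation_time_integral YL phi_L2).2; congr (_%:E).
apply: (pairing_duality P_complete W_brownian phi_L2 psi_L2 X_sol YZ_sol
  (K := K1 + K2 + K3 + K4) _ ma0 ma1 mc0 mc1 _ _ _ _ a0E a1E c0D c1D c0E c1E).
- by rewrite !addr_ge0.
- by move=> i j q; rewrite (le_trans (a0K i j q))//; lra.
- by move=> i j q; rewrite (le_trans (a1K i j q))//; lra.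
- by move=> i j q; rewrite (le_trans (c0K i j q))//; lra.
- by move=> i j q; rewrite (le_trans (c1K i j q))//; lra.
Qed.
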